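(* Let $t\in(1,2)$ be a mixing Misiurewicz--Thurston parameter of the quadratic family $f_t(x)=t-x^2$ and let $\phi$ be a compactly supported $C^1$ function. Then, as formal power series in $z$ (i.e. coefficient by coefficient), $$\lim_{\eta\uparrow1}\Psi^{\mathrm{fr}}_\phi(\eta,z)=\lim_{\eta\uparrow1}\Psi^{\mathrm{rsp}}_\phi(\eta,z)=\Psi_\phi(z).$$
   Context: **Quadratic family.** For $t\in(1,2)$, $f_t(x)=t-x^2$; $c_{k,t}=f_t^k(0)$. Put $a_t=\frac{-1-\sqrt{1+4t}}2$ and $I_t=[a_t,-a_t]$. $m$ (also $dx$) is Lebesgue measure. The parameter $t$ is Misiurewicz--Thurston (MT) if there exist $L\ge1$, $P\ge1$ such that $c_{L,t}$ is periodic of minimal period $P$ with $|Df_t^P(c_{L,t})|>1$. Then $f_t$ has an absolutely continuous invariant probability measure $\mu_t=\rho_t\,dm$ with $\mathrm{supp}\,\rho_t=[c_{2,t},c_{1,t}]$; $t$ is mixing if $(f_t,\mu_t)$ is mixing. **Transfer operator and extension in the parameter.** $\mathcal L_s\psi(x)=\mathbf 1_{x<s}\,\frac{\psi(\sqrt{s-x})+\psi(-\sqrt{s-x})}{2\sqrt{s-x}}$. Fix $\epsilon>0$ small, with $[t-\epsilon,t+\epsilon]\subset(1,2)$ and $[c_{2,t},c_{1,t}]\subset\mathrm{int}\bigl(\bigcap_{\tau\in[t-\epsilon,t+\epsilon]}I_\tau\bigr)=:I_{t,\epsilon}$; extend the family to all real parameters by keeping $f_\tau$ for $|\tau-t|\le\epsilon$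 and setting $f_\tau=f_{t-\epsilon}$ for $\tau<t-\epsilon$, $f_\tau=f_{t+\epsilon}$ for $\tau>t+\epsilon$; $\mathcal L_\tau$ is the transfer operator of the extended family, and $\epsilon$ is small enough that all $\mathcal L_\tau\rho_t$ are supported in $I_{t,\epsilon}\subset I_t$. **Marchaud derivative.** $M^\eta g(x)=\lim_{\epsilon'\downarrow0}\frac{\eta}{2\Gamma(1-\eta)}\int_{|\tau|>\epsilon'}\frac{g(x+\tau)-g(x)}{|\tau|^{1+\eta}}\mathrm{sgn}(\tau)\,d\tau$; a subscript ($M^\eta_x$, $M^\eta_s$) indicates the variable on which it acts. **Susceptibility functions** (formal power series in $z$): $$\Psi_\phi(z)=\sum_{k\ge0}z^k\int(\phi\circ f_t^k)'\,\rho_t\,dm,\qquad \Psi^{\mathrm{rsp}}_\phi(\eta,z)=\sum_{k\ge0}z^k\int_{I_t}M^\eta_x(\phi\circ f_t^k)\,\rho_t\,dm,$$ $$\Psi^{\mathrm{fr}}_\phi(\eta,z)=\sum_{k\ge0}z^k\int_{I_t}(\phi\circ f_t^k)(x)\,M^\eta_s(\mathcal L_s\rho_t(x))|_{s=t}\,dx,$$ where in the last formula $M^\eta_s$ is taken in the sense of distributions of order one in $x$: with $R_s(x)=\int_{-\infty}^x\mathcal L_s\rho_t\,dm$, its pairing with a compactly supported $C^1$ function $\psi$ is $-\int\bigl[\lim_{\epsilon'\downarrow0}\frac{\eta}{2\Gamma(1-\eta)}\int_{|\delta|>\epsilon'}\frac{R_{t+\delta}(x)-R_t(x)}{|\delta|^{1+\eta}}\mathrm{sgn}(\delta)\,d\delta\bigr]\psi'(x)\,dx$.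 *)

(* Defs.v *)
From HB Require Import structures.
From mathcomp Require Import all_boot all_order all_algebra.
From mathcomp Require Import all_classical all_reals all_analysis.

Set Implicit Arguments.
Unset Strict Implicit.
Unset Printing Implicit Defensive.

Import Order.TTheory GRing.Theory Num.Theory.
Import numFieldNormedType.Exports.

Local Open Scope classical_set_scope.
Local Open Scope ring_scope.

Section quadratic_family.
Context {R : realType}.
Implicit Types (t x eta : R) (f g phi psi rho : R -> R).

Definition quad t x : R := t - x ^+ 2.

Definition crit t (k : nat) : R := iter k (quad t) 0.

Definition qleft t : R := (- 1 - Num.sqrt (1 + 4 * t)) / 2.

Definition qinterval t : set R := `[qleft t, - qleft t]%classic.

Definition has_min_period f x (P : nat) : Prop :=
  [/\ (1 <= P)%N, iter P f x = x
    & forall j : nat, (1 <= j < P)%N -> iter j f x <> x].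

Definition misiurewicz_thurston t : Prop :=
  exists L P : nat, [/\ (1 <= L)%N,
    has_min_period (quad t) (crit t L) P
    & 1 < `| derive1 (iter P (quad t)) (crit t L) |].

(* Topological support of the measure g dm: unlike the closure of the nonzero
   set, it does not depend on the choice of g in its a.e. class. *)
Definition ess_supp g : set R :=
  [set x | forall U : set R, open_nbhs x U ->
     ~ {ae (@lebesgue_measure R), forall y, U y -> g y = 0}].

(* Densities are only determined a.e.; rho is any nonnegative Borel version. *)
Record acip_density t (mu : probability (measurableTypeR R) R) rho : Prop :=
  AcipDensity {
    acip_measurable : measurable_fun [set: R] rho ;
    acip_ge0 : forall x, 0 <= rho x ;
    acip_density_eq : forall A : set R, measurable A ->
      mu A = (\int[lebesgue_measure]_(x in A) (rho x)%:E)%E ;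
    acip_invariant : forall A : set R, measurable A ->
      mu (quad t @^-1` A) = mu A ;
    acip_supp : ess_supp rho = `[crit t 2, crit t 1]%classic
  }.

Definition mixing (mu : probability (measurableTypeR R) R) f : Prop :=
  forall A B : set R, measurable A -> measurable B ->
    mu (iter n f @^-1` A `&` B) @[n --> \oo] --> (mu A * mu B)%E.

Definition transfer (s : R) psi x : R :=
  if x < s then
    (psi (Num.sqrt (s - x)) + psi (- Num.sqrt (s - x))) / (2 * Num.sqrt (s - x))
  else 0.

(* The extended family is f_(clamp t eps tau) for tau in R. *)
Definition clamp t (eps tau : R) : R :=
  if tau < t - eps then t - eps else if t + eps < tau then t + eps else tau.

Definition transfer_ext t (eps tau : R) psi : R -> R :=
  transfer (clamp t eps tau) psi.

Definition core_interval t (eps : R) : set R :=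
  (\bigcap_(tau in `[t - eps, t + eps]%classic) qinterval tau)°.

(* core_interval t eps is contained in qinterval t as soon as 0 < eps. *)
Definition admissible_eps t rho (eps : R) : Prop :=
  [/\ 0 < eps,
      `[t - eps, t + eps]%classic `<=` `]1, 2[%classic,
      `[crit t 2, crit t 1]%classic `<=` core_interval t eps
    & forall tau : R, ess_supp (transfer_ext t eps tau rho)
                      `<=` core_interval t eps].

Definition C1_compact_support phi : Prop :=
  [/\ forall x, derivable phi x 1, continuous (derive1 phi)
    & compact (closure [set x | phi x != 0])].

(* Euler's Gamma function, meaningful for a > 0. *)
Definition Gamma (a : R) : R :=
  \int[lebesgue_measure]_(u in `]0, +oo[) (u `^ (a - 1) * expR (- u)).

Definition marchaud eta g x : R :=
  lim ((eta / (2 * Gamma (1 - eta)) *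
        \int[lebesgue_measure]_(tau in [set tau : R | e < `|tau|])
          ((g (x + tau) - g x) / `|tau| `^ (1 + eta) * Num.sg tau))
       @[e --> 0^'+]).

Definition cumul t (eps : R) rho (s x : R) : R :=
  \int[lebesgue_measure]_(y in `]-oo, x]) transfer_ext t eps s rho y.

(* Pairing of psi with M^eta_s (L_s rho) at s = t, an order-one distribution in
   x: the x-derivative of M^eta_s R_s(x) at s = t, R_s(x) being cumul. *)
Definition marchaud_transfer_pairing eta t (eps : R) rho psi : R :=
  - \int[lebesgue_measure]_(x in [set: R])
      (marchaud eta (fun s => cumul t eps rho s x) t * derive1 psi x).

(* A formal power series in z is given by its sequence of coefficients. *)

Definition Psi t rho phi : nat -> R := fun k =>
  \int[lebesgue_measure]_(x in [set: R])
    (derive1 (phi \o iter k (quad t)) x * rho x).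

Definition Psi_rsp eta t rho phi : nat -> R := fun k =>
  \int[lebesgue_measure]_(x in qinterval t)
    (marchaud eta (phi \o iter k (quad t)) x * rho x).

(* The integral over qinterval t of the product with M^eta_s (L_s rho) is the
   pairing; the distribution is supported in core_interval t eps. *)
Definition Psi_fr eta t (eps : R) rho phi : nat -> R := fun k =>
  marchaud_transfer_pairing eta t eps rho (phi \o iter k (quad t)).

End quadratic_family.

(* Main.v *)
(* The kernel eta / (2 Gamma(1 - eta)) * sgn(tau) / |tau|^(1 + eta) concentrates
   at 0 as eta tends to 1: if g is bounded and |g(tau) - a tau| <= w |tau| near 0,
   then its integral against g is within 4 w of a for eta close to 1, uniformly
   in g. With g(tau) = psi(x + tau) - psi(x) and psi = phi o f_t^k, the Marchaud
   derivatives of psi converge uniformly to psi', which settles the response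
   side. On the frequency side, f_s = f_t + (s - t) makes L_s rho_t the translate
   by s - t of L_t rho_t = rho_t, so that R_(t + delta)(x) = R_t(x - delta) for
   small delta; Fubini and an integration by parts turn the pairing into the
   integral of the same kernel against
     g(delta) = int (psi(y + delta) - psi(y)) rho_t(y) dy,
   whose slope at 0 is int psi' rho_t. *)
From HB Require Import structures.
Require Import Defs.
From mathcomp Require Import all_boot all_order all_algebra.
From mathcomp Require Import all_classical all_reals all_analysis.
From mathcomp Require Import measurable_realfun.
From mathcomp Require Import lra ring.
Import Order.TTheory GRing.Theory Num.Theory.
Import numFieldNormedType.Exports.
Local Open Scope classical_set_scope.
Local Open Scope ring_scope.

(** Two obstacles shape the proof. The function [marchaud eta psi] is a pointwise [lim], and its
    measurability in x is never established; it is therefore compared with measurable functions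
    through estimates that tolerate nonmeasurable integrands, at the price of a factor 2. Moreover
    [rho] is only known to be integrable, so its primitive need not be Lipschitz and the kernel
    integral of the primitive may diverge at some x. What survives is a Lipschitz bound in L^1: the
    increment by h has norm at most |h| times the mass of [rho]. This is what makes Fubini
    applicable, and it controls the kernel integral at almost every x.

    The normalization works because the integral of |tau|^(-eta) over |tau| <= r is 2 r^(1 - eta) /
    (1 - eta), while (1 - eta) Gamma(1 - eta) tends to 1: the first moment of the kernel on |tau| <=
    r tends to 1 and the part |tau| > r dies out. In the bound 4 w, a factor 2 is the price
    mentioned above, and the other leaves room for the errors that vanish in the limit.

    Invariance of [rho] is used only after integration over Borel sets, which suffices to identify
    R_t with the primitive of [rho] at every x. *)

(** * Comparison of integrals without measurability *)

Section lower_integral.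
Context d (T : measurableType d) (R : realType).
Variable mu : {measure set T -> \bar R}.
Local Open Scope ereal_scope.

(* No measurability is needed since the integral of a nonnegative function is
   a supremum over the simple functions below it. *)
Lemma le_lower_integral (D : set T) (f g : T -> \bar R) :
  (forall x, D x -> 0 <= f x) -> (forall x, D x -> f x <= g x) ->
  \int[mu]_(x in D) f x <= \int[mu]_(x in D) g x.
Proof.
move=> f0 fg; rewrite !ge0_integralE//; last first.
  by move=> x Dx; rewrite (le_trans (f0 _ Dx))// fg.
apply: le_ereal_sup => _ [h /= hf <-]; exists h => //= x.
apply: le_trans (hf x) _; rewrite /patch; case: ifPn => //.
by rewrite inE => /fg.
Qed.

Lemma ge0_integral_perturb (D : set T) (f g h : T -> \bar R) :
  measurable D -> measurable_fun D g -> measurable_fun D h ->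
  (forall x, D x -> 0 <= f x) -> (forall x, D x -> 0 <= g x < +oo) ->
  (forall x, D x -> 0 <= h x) ->
  (forall x, D x -> f x <= g x + h x) -> (forall x, D x -> g x <= f x + h x) ->
  \int[mu]_(x in D) f x <= \int[mu]_(x in D) g x + \int[mu]_(x in D) h x /\
  \int[mu]_(x in D) g x <= \int[mu]_(x in D) f x + \int[mu]_(x in D) h x.
Proof.
move=> mD mg mh f0 g0 h0 fgh gfh.
have g0' x : D x -> 0 <= g x by move=> /g0 /andP[].
split; first by rewrite -ge0_integralD//; exact: le_lower_integral.
(* The integral of [f + h] cannot be split, [f] being possibly nonmeasurable. The measurable
   function [k] lies below [f] and satisfies [g <= k + h], so the splitting is done on [k + h]
   instead. *)
pose k x := maxe (g x - h x) 0.
have k0 x : D x -> 0 <= k x by move=> Dx; rewrite le_max lexx orbT.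
have mk : measurable_fun D k.
  by apply: measurable_maxe => //; exact: emeasurable_funB.
apply: (@le_trans _ _ (\int[mu]_(x in D) k x + \int[mu]_(x in D) h x)).
  rewrite -ge0_integralD//; apply: le_lower_integral => // x Dx.
  have := h0 _ Dx; have := k0 _ Dx; rewrite /k.
  case: (h x) => [r| |]// kx _; last first.
    by rewrite addey ?leey// -ltNye (lt_le_trans _ kx).
  by rewrite -leeBlDr// le_max lexx.
rewrite leeD2r//; apply: le_lower_integral => // x Dx.
rewrite /k ge_max f0// andbT.
have := h0 _ Dx; have := gfh _ Dx; have /andP[_] := g0 _ Dx.
case: (h x) => [r| |]//; first by rewrite leeBlDr.
by case: (g x) => [r| |]// *; rewrite leNye.
Qed.

(** Positive and negative parts are 1-Lipschitz operations, so each of the two integrals moves by at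
    most the integral of [h]; hence the factor 2. The function [f] may be nonmeasurable, which is
    the case of use. *)
Lemma Rintegral_perturb (D : set T) (f g : T -> R) (h : T -> \bar R) :
  measurable D -> mu.-integrable D (EFin \o g) -> measurable_fun D h ->
  \int[mu]_(x in D) h x < +oo ->
  (forall x, D x -> (`|f x - g x|)%:E <= h x) ->
  (`|Rintegral mu D f - Rintegral mu D g| <= 2 * fine (\int[mu]_(x in D) h x))%R.
Proof.
move=> mD ig mh hoo fgh.
have h0 x : D x -> 0 <= h x by move=> /fgh; apply: le_trans; rewrite lee_fin.
have mg := measurable_int _ ig.
have lip (a b c : R) (e : \bar R) : (`|a - b| <= c)%R -> c%:E <= e -> a%:E <= b%:E + e.
  move=> abc ce; apply: (@le_trans _ _ (b%:E + c%:E)); last by rewrite leeD2l.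
  by rewrite -EFinD lee_fin; move: abc; rewrite ler_norml => /andP[_]; lra.
have maxlip (a b : R) : (`|Num.max a 0 - Num.max b 0| <= `|a - b|)%R.
  have := ler_norm (a - b); have := ler_norm (b - a); rewrite (distrC b).
  have := normr_ge0 (a - b)%R; move: (`|a - b|)%R => n n0 ban abn.
  by rewrite ler_norml; case: (lerP a 0); case: (lerP b 0) => b0 a0; apply/andP; split; lra.
have [|||||P1 P2] := @ge0_integral_perturb D ((EFin \o f)^\+) ((EFin \o g)^\+) h mD
  (measurable_funepos mg) mh.
- by move=> *; exact: funepos_ge0.
- by move=> x Dx; rewrite funepos_ge0/= funeposE/= -EFin_max ltry.
- by [].
- move=> x Dx; rewrite !funeposE/= -!EFin_max; apply: lip (fgh _ Dx).
  exact: maxlip.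
- move=> x Dx; rewrite !funeposE/= -!EFin_max; apply: lip (fgh _ Dx).
  by rewrite distrC; exact: maxlip.
have [|||||N1 N2] := @ge0_integral_perturb D ((EFin \o f)^\-) ((EFin \o g)^\-) h mD
  (measurable_funeneg mg) mh.
- by move=> *; exact: funeneg_ge0.
- by move=> x Dx; rewrite funeneg_ge0/= funenegE/= -EFin_max ltry.
- by [].
- move=> x Dx; rewrite !funenegE/= -!EFin_max; apply: lip (fgh _ Dx).
  by rewrite (le_trans (maxlip _ _))// distrC opprK addrC.
- move=> x Dx; rewrite !funenegE/= -!EFin_max; apply: lip (fgh _ Dx).
  by rewrite (le_trans (maxlip _ _))// opprK addrC.
rewrite /Rintegral (integralE _ _ (fun x => (f x)%:E)) (integralE _ _ (fun x => (g x)%:E)).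
have := integrable_pos_fin_num mD ig; have := integrable_neg_fin_num mD ig.
have : \int[mu]_(x in D) h x \is a fin_num.
  by rewrite ge0_fin_numE// integral_ge0.
move: P1 P2 N1 N2.
have : 0 <= \int[mu]_(x in D) ((EFin \o f)^\+) x by apply: integral_ge0 => *; exact: funepos_ge0.
have : 0 <= \int[mu]_(x in D) ((EFin \o f)^\-) x by apply: integral_ge0 => *; exact: funeneg_ge0.
rewrite -/(_ \o _) -/(_ \o _).
move: (\int[mu]_(x in D) h x) => [H| |]//.
move: (\int[mu]_(x in D) ((EFin \o f)^\+) x) => [P| |]// + +;
  move: (\int[mu]_(x in D) ((EFin \o g)^\+) x) => [p| |]// + +;
  move: (\int[mu]_(x in D) ((EFin \o g)^\-) x) => [n| |]// + +;
  move: (\int[mu]_(x in D) ((EFin \o f)^\-) x) => [N| |]//.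
rewrite /= -!EFinD !lee_fin => *.
by rewrite ler_norml; apply/andP; split; lra.
Qed.

End lower_integral.

(** * Measures given by a density *)

Section density.
Context d (T : measurableType d) (R : realType).
Variable mu : {measure set T -> \bar R}.
Variable w : T -> R.
Hypothesis mw : measurable_fun [set: T] w.
Hypothesis w0 : forall x, 0 <= w x.
Local Open Scope ereal_scope.

(* Taking the proofs as arguments lets the measure instance be inferred. *)
Definition density of measurable_fun [set: T] w & (forall x, (0 <= w x)%R) :=
  fun A : set T => \int[mu]_(x in A) (w x)%:E.

Local Notation nu := (density mw w0).

Let density0 : nu set0 = 0.
Proof. exact: integral_set0. Qed.

Let density_ge0 A : 0 <= nu A.
Proof. by apply: integral_ge0 => x _; rewrite lee_fin. Qed.

Let density_sigma_additive : semi_sigma_additive nu.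
Proof.
move=> F mF tF mUF; rewrite /density ge0_integral_bigcup//=.
- by apply: is_cvg_ereal_nneg_natsum_cond => n _ _; exact: density_ge0.
- exact/measurable_EFinP/measurable_funTS.
- by move=> x _; rewrite lee_fin.
Qed.

HB.instance Definition _ := isMeasure.Build _ _ _ nu
  density0 density_ge0 density_sigma_additive.

Import HBNNSimple.

(** Monotone approximation of [g] by simple functions reduces the formula to indicators, where it is
    the definition of [density]. *)
Lemma integral_density (g : T -> \bar R) :
  measurable_fun [set: T] g -> (forall x, 0 <= g x) ->
  \int[nu]_x g x = \int[mu]_x (g x * (w x)%:E).
Proof.
move=> mg g0; pose g_ := nnsfun_approx measurableT mg.
have mw' : measurable_fun [set: T] (EFin \o w) by exact/measurable_EFinP.
transitivity (limn (fun n => \int[nu]_x (g_ n x)%:E)).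
  rewrite -monotone_convergence//=.
  - by apply: eq_integral => x _; apply/esym/cvg_lim => //; exact: cvg_nnsfun_approx.
  - by move=> n; exact/measurable_EFinP/measurable_funP.
  - by move=> n x _; rewrite lee_fin.
  - by move=> x _ m n mn; rewrite lee_fin; exact/lefP/nd_nnsfun_approx.
transitivity (limn (fun n => \int[mu]_x ((g_ n x)%:E * (w x)%:E))); last first.
  rewrite -monotone_convergence//=.
  - apply: eq_integral => x _; apply/cvg_lim => //.
    by apply: cvgeMr => //; exact: cvg_nnsfun_approx.
  - by move=> n; apply: emeasurable_funM => //; exact/measurable_EFinP/measurable_funP.
  - by move=> n x _; rewrite mule_ge0 ?lee_fin.
  - move=> x _ m n mn; apply: lee_wpmul2r; first by rewrite lee_fin.
    by rewrite lee_fin; exact/lefP/nd_nnsfun_approx.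
apply: congr_lim; apply/funext => n.
have mfn k : measurable (g_ n @^-1` [set k]).
  by rewrite -[X in measurable X]setTI; exact: measurable_funP.
transitivity (\sum_(k \in range (g_ n))
    \int[nu]_x (k * \1_(g_ n @^-1` [set k]) x)%:E).
  under eq_integral do rewrite fimfunE -fsumEFin//.
  rewrite ge0_integral_fsum//.
  - by move=> y; exact/measurable_EFinP/measurable_funM.
  - by move=> y x _; rewrite nnfun_muleindic_ge0.
transitivity (\sum_(k \in range (g_ n))
    \int[mu]_x ((k * \1_(g_ n @^-1` [set k]) x)%:E * (w x)%:E)); last first.
  rewrite -ge0_integral_fsum//.
  - apply: eq_integral => x _.
    rewrite -ge0_mule_fsuml; last by move=> i; rewrite nnfun_muleindic_ge0.
    by rewrite fsumEFin// -fimfunE.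
  - move=> y; apply: emeasurable_funM => //.
    exact/measurable_EFinP/measurable_funM.
  - by move=> y x _; rewrite mule_ge0 ?lee_fin// -lee_fin nnfun_muleindic_ge0.
apply: eq_fsbigr => k _.
have [k0|k0] := ltP k 0%R.
  rewrite preimage_nnfun0// indic0 !integral0_eq// => x _ /=; rewrite ?mulr0 ?mul0e//.
under [LHS]eq_integral do rewrite EFinM.
rewrite ge0_integralZl//=; last exact/measurable_EFinP.
rewrite integral_indic// setIT.
under [RHS]eq_integral do rewrite EFinM -muleA.
rewrite ge0_integralZl//=; last 2 first.
  - by apply: emeasurable_funM => //; exact/measurable_EFinP.
  - by move=> x _; rewrite mule_ge0 ?lee_fin.
congr (_ * _); rewrite /density integral_mkcond; apply: eq_integral => x _.
by rewrite /patch indicE; case: (x \in _); rewrite ?mul1e ?mul0e.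
Qed.

End density.

(** * Translation and reflection invariance of Lebesgue integrals *)

Section lebesgue_invariance.
Context {R : realType}.
Notation mu := (@lebesgue_measure R).
Local Open Scope ereal_scope.

Lemma lebesgue_measure_shift (c : R) (A : set R) : measurable A ->
  pushforward mu ((fun x => x + c)%R : _ -> measurableTypeR R) A = mu A.
Proof.
move=> mA; apply/esym/lebesgue_measure_unique => //=; [exact: measurable_funD|move=> ?].
move=> _ [[a b]] _ <-.
rewrite /pushforward/= (_ : _ @^-1` _ = `](a - c)%R, (b - c)%R]%classic); last first.
  by apply/seteqP; split => x /=; rewrite !in_itv/=; lra.
rewrite !lebesgue_measure_itv/= !lte_fin ltrD2r.
by case: ifPn => // _; rewrite -!EFinB; congr (_%:E); lra.
Qed.

Lemma ge0_integral_shift (c : R) (f : R -> \bar R) :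
  measurable_fun [set: R] f -> (forall x, 0 <= f x) ->
  \int[mu]_x f (x + c)%R = \int[mu]_x f x.
Proof.
move=> mf f0.
have mc : measurable_fun setT ((fun x => x + c)%R : measurableTypeR R -> measurableTypeR R).
  exact: measurable_funD.
have := ge0_integral_pushforward mc mu measurableT mf (fun x _ => f0 x).
rewrite preimage_setT /= => <-.
by apply: eq_measure_integral => A mA _; exact: lebesgue_measure_shift.
Qed.

Lemma ge0_integral_opp (f : R -> \bar R) :
  measurable_fun [set: R] f -> (forall x, 0 <= f x) ->
  \int[mu]_x f (- x)%R = \int[mu]_x f x.
Proof.
move=> mf f0.
have mN : measurable_fun setT (-%R : measurableTypeR R -> measurableTypeR R) by [].
have := ge0_integral_pushforward mN mu measurableT mf (fun x _ => f0 x).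
rewrite preimage_setT /= => <-.
by apply: eq_measure_integral => A mA _; exact: lebesgue_measureN.
Qed.

End lebesgue_invariance.

(** * Improper integrals on the line *)

Section lebesgue_line.
Context {R : realType}.
Notation mu := (@lebesgue_measure R).

(** Dominated convergence along sequences decreasing to 0 or merely tending to it from the right,
    with |k| as dominating function. The value at 0, the only point missed by every punctured set,
    is asked to be 0 so that pointwise convergence holds everywhere. *)
Lemma cvg_punctured_integral (k : R -> R) :
  mu.-integrable [set: R] (EFin \o k) -> k 0 = 0 ->
  \int[mu]_(x in [set x | e < `|x|]) k x @[e --> 0^'+] --> \int[mu]_x k x.
Proof.
move=> ik k0; apply/cvg_at_rightP => u [u0 ucvg].
apply: fine_cvg; rewrite fineK ?integrable_fin_num//.
have mE n : measurable [set x : R | u n < `|x|].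
  rewrite [X in measurable X](_ : _ = (fun x : R => `|x|) @^-1` `]u n, +oo[).
    by rewrite -[X in measurable X]setTI; exact: normr_measurable.
  by apply/seteqP; split => x /=; rewrite in_itv/= andbT.
have mk := measurable_int _ ik.
pose f_ n : R -> \bar R := (EFin \o k) \_ [set x : R | u n < `|x|].
have [|||||] // := @dominated_convergence _ _ _ mu setT measurableT f_ (EFin \o k) (abse \o (EFin \o k)).
- move=> n; apply: (measurable_restrictT (EFin \o k) (mE n)).1.
  exact: (measurable_funS measurableT (@subsetT _ _) mk).
- apply: aeW => x _; apply: cvg_near_cst; rewrite /f_.
  have [->|x0] := eqVneq x 0.
    by apply: nearW => n; rewrite /patch/= k0; case: ifP.
  have xp : 0 < `|x| by rewrite normr_gt0.
  near=> n; rewrite patchE mem_set//=; near: n.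
  exact: (cvgr_lt _ ucvg _ xp).
- exact: integrable_abse.
- apply: aeW => x n _; rewrite /f_ /patch; case: ifPn => // _.
  by rewrite [point](_ : _ = 0%E)// abse0 abse_ge0.
move=> _ _; apply: cvg_trans; apply: near_eq_cvg; apply: nearW => n.
by rewrite [RHS]integral_mkcond.
Unshelve. all: by end_near. Qed.

(** An improper version of the fundamental theorem: [f] may blow up at [a], as negative powers and
    the derivative of the square root do at 0. Monotone convergence on the exhausting segments
    replaces continuity of [f] at [a]. *)
Lemma ge0_FTC2_oc (f F : R -> R) (a b : R) : a < b ->
  (forall x, a < x -> 0 <= f x) -> (forall x, a < x -> {for x, continuous f}) ->
  (forall x, a < x -> derivable F x 1) -> (forall x, a < x -> derive1 F x = f x) ->
  F x @[x --> a^'+] --> F a ->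
  (\int[mu]_(x in `]a, b]) (f x)%:E = (F b - F a)%:E)%E.
Proof.
move=> ab f0 cf dF F'f Fa.
(* The denominator n + 2, instead of n + 1, makes [c 0 < b] strict. *)
pose c n : R := a + (b - a) / n.+2%:R.
have ba0 : 0 < b - a by rewrite subr_gt0.
have ca n : a < c n by rewrite ltrDl divr_gt0.
have cb n : c n < b.
  by rewrite /c -ltrBrDl ltr_pdivrMr// ltr_pMr// ltr1n.
have cvgc : c n @[n --> \oo] --> a.
  rewrite -[X in _ --> X]addr0; apply: cvgD; first exact: cvg_cst.
  rewrite -(mulr0 (b - a)); apply: cvgM; first exact: cvg_cst.
  by move: (@cvg_harmonic R); rewrite -cvg_shiftS.
have ndc : nonincreasing_seq c.
  move=> m n mn; rewrite lerD2l ler_pM2l// lef_pV2 ?posrE// ler_nat//.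
have E : \bigcup_n `[c n, b]%classic = `]a, b]%classic.
  apply/seteqP; split => [x [n _]|x] /=; rewrite !in_itv/=.
    by move=> /andP[cx ->]; rewrite (lt_le_trans (ca n)).
  move=> /andP[ax xb].
  have [n _ /(_ n (leqnn _)) /= cn] := cvgr_lt _ cvgc _ ax.
  by exists n => //=; rewrite in_itv/= xb ltW.
have cfw n : {within `[c n, b], continuous f}.
  apply: continuous_in_subspaceT => x /[!inE]/=; rewrite in_itv/= => /andP[cx _].
  by apply: cf; rewrite (lt_le_trans (ca n)).
have H : (\int[mu]_(x in `[c n, b]) (f x)%:E @[n --> \oo] -->
    \int[mu]_(x in `]a, b]) (f x)%:E)%E.
  rewrite -E; apply: ge0_nondecreasing_set_cvg_integral => //.
  - move=> m n mn; apply/subsetPset => x /=; rewrite !in_itv/= => /andP[cx ->].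
    by rewrite (le_trans (ndc _ _ mn)).
  - move=> n; apply/measurable_EFinP; apply: subspace_continuous_measurable_fun => //.
  - move=> n x /=; rewrite in_itv/= lee_fin => /andP[cx _].
    by apply: f0; rewrite (lt_le_trans (ca n)).
have dFc n x : c n <= x -> {for x, continuous F}.
  by move=> cx; apply/differentiable_continuous/derivable1_diffP/dF; rewrite (lt_le_trans (ca n)).
have G n : (\int[mu]_(x in `[c n, b]) (f x)%:E = (F b - F (c n))%:E)%E.
  rewrite (continuous_FTC2 (F := F)) ?EFinB//.
  - split.
    + by move=> x; rewrite in_itv/= => /andP[cx _]; apply: dF; rewrite (lt_trans (ca n)).
    + by apply: cvg_at_right_filter; exact: (dFc n).
    + by apply: cvg_at_left_filter; apply: (dFc n); exact: ltW.
  - by move=> x; rewrite in_itv/= => /andP[cx _]; apply: F'f; rewrite (lt_trans (ca n)).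
have {}H : ((F b - F (c n))%:E @[n --> \oo] --> \int[mu]_(x in `]a, b]) (f x)%:E)%E.
  by move: H; under eq_fun do rewrite G.
have H' : (F b - F (c n))%:E @[n --> \oo] --> (F b - F a)%:E.
  apply: cvg_EFin; first exact: nearW.
  apply: cvgB; first exact: cvg_cst.
  by move/cvg_at_rightP : Fa; apply.
exact: (cvg_unique _ H H').
Qed.

End lebesgue_line.

(** * Almost everywhere equality with a measurable function *)

Section ae_eq_lower_integral.
Context d (T : measurableType d) (R : realType).
Variable mu : {measure set T -> \bar R}.
Local Open Scope ereal_scope.

(** Resetting [g] on the exceptional null set to 0 and to +oo gives measurable [g1] and [g2] with
    [g1 <= f <= g2] everywhere. Both have the integral of [g], so monotonicity of the integral
    squeezes that of [f]. *)
Lemma ge0_ae_eq_lower_integral (f g : T -> \bar R) :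
  measurable_fun [set: T] g -> (forall x, 0 <= f x) -> (forall x, 0 <= g x) ->
  {ae mu, forall x, f x = g x} -> \int[mu]_x f x = \int[mu]_x g x.
Proof.
move=> mg f0 g0 [B [mB B0 fgB]].
have fg x : ~ B x -> f x = g x by move=> Bx; apply: contrapT => /fgB.
pose g1 := g \_ (~` B); pose g2 x := if x \in B then +oo else g x.
have mCB : measurable (~` B) by exact: measurableC.
have mg1 : measurable_fun [set: T] g1.
  by apply: (measurable_restrictT _ mCB).1; exact: measurable_funTS.
have mg2 : measurable_fun [set: T] g2.
  apply: measurable_fun_ifT => //.
  by apply: (measurable_fun_bool true); rewrite setTI preimage_mem_true.
have ae1 : ae_eq mu [set: T] g g1.
  exists B; split => // x /= /not_implyP[_ h]; apply: contrapT => Bx; apply: h.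
  by rewrite /g1 patchE mem_set.
have ae2 : ae_eq mu [set: T] g g2.
  exists B; split => // x /= /not_implyP[_ h]; apply: contrapT => Bx; apply: h.
  by rewrite /g2 memNset.
apply/eqP; rewrite eq_le; apply/andP; split.
  rewrite (ae_eq_integral _ _ measurableT mg mg2 ae2).
  apply: le_lower_integral => // x _; rewrite /g2.
  by case: ifPn => [_|]; [rewrite leey|rewrite notin_setE => /fg ->].
rewrite (ae_eq_integral _ _ measurableT mg mg1 ae1).
apply: le_lower_integral => x _; first by apply: erestrict_ge0.
rewrite /g1 patchE; case: ifPn => [|_]; last exact: f0.
by rewrite in_setC => /negP; rewrite inE => /fg ->.
Qed.

Lemma ae_eq_lower_integral (f g : T -> \bar R) : measurable_fun [set: T] g ->
  {ae mu, forall x, f x = g x} -> \int[mu]_x f x = \int[mu]_x g x.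
Proof.
move=> mg [B [mB B0 fgB]]; rewrite integralE [RHS]integralE.
by congr (_ - _); apply: ge0_ae_eq_lower_integral;
  do ?[exact: measurable_funepos|exact: measurable_funeneg];
  (try by move=> x; rewrite ?funepos_ge0 ?funeneg_ge0);
  exists B; split => // x /= h; apply: fgB => /= fg; apply: h;
  rewrite ?funeposE ?funenegE fg.
Qed.

End ae_eq_lower_integral.

(** * Integrals of powers *)

Section power_integrals.
Context {R : realType}.
Notation mu := (@lebesgue_measure R).

(** As [P] vanishes on the nonpositive half line, P(|u|) = P(u) + P(-u). *)
Lemma ge0_integral_norm (P : R -> R) : measurable_fun [set: R] P ->
  (forall u, 0 <= P u) -> (forall u, u <= 0 -> P u = 0) ->
  (\int[mu]_u (P `|u|)%:E = 2%:E * \int[mu]_u (P u)%:E)%E.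
Proof.
move=> mP P0 Pneg.
have mP' : measurable_fun [set: R] (EFin \o P) by exact/measurable_EFinP.
transitivity (\int[mu]_u ((P u)%:E + (P (- u))%:E))%E.
  apply: eq_integral => u _; rewrite -EFinD; congr EFin.
  have [u0|u0] := leP 0 u.
    by rewrite ger0_norm// (Pneg (- u)) ?addr0// oppr_le0.
  by rewrite ltr0_norm// (Pneg u) ?add0r// ltW.
rewrite ge0_integralD//=; last 3 first.
- by move=> *; rewrite lee_fin.
- by move=> *; rewrite lee_fin.
- apply/measurable_EFinP; exact: measurableT_comp.
rewrite (ge0_integral_opp _ mP') /=; last by move=> x; rewrite lee_fin.
by rewrite -mule2n mule_natl.
Qed.

Lemma integral_powR_oc (a r : R) : 0 < a -> 0 < r ->
  (\int[mu]_(x in `]0%R, r]) (x `^ (a - 1))%:E = (r `^ a / a)%:E)%E.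
Proof.
move=> a0 r0.
have D (x : R) : 0 < x -> is_derive x 1 (fun x : R => x `^ a / a) (x `^ (a - 1)).
  move=> x0; have := is_derive1_powR a x0 => H.
  have := is_deriveM H (is_derive_cst (a^-1) x 1).
  by rewrite scaler0 add0r /= -[_ *: _]/(a^-1 * _) mulrA mulVf ?gt_eqF// mul1r.
rewrite (@ge0_FTC2_oc R _ (fun x => x `^ a / a) 0 r)//.
- by rewrite powR0 ?gt_eqF// mul0r subr0.
- by move=> x x0; exact: powR_ge0.
- move=> x x0; apply/differentiable_continuous/derivable1_diffP.
  by apply: derivable_powR; rewrite in_itv/= x0.
- by move=> x /D ?; exact: ex_derive.
- by move=> x /D H; rewrite derive1E derive_val.
- rewrite powR0 ?gt_eqF//; apply: cvgM; last exact: cvg_cst.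
  exact: powR_cvg0.
Qed.

Lemma integral_powR_oy (a r : R) : 0 < a -> 0 < r ->
  (\int[mu]_(x in `]r, +oo[) (x `^ (- 1 - a))%:E = (r `^ (- a) / a)%:E)%E.
Proof.
move=> a0 r0.
have D (x : R) : 0 < x -> is_derive x 1 (fun x : R => - (x `^ (- a) / a)) (x `^ (- 1 - a)).
  move=> x0; have := is_derive1_powR (- a) x0 => H.
  have := is_deriveN (is_deriveM H (is_derive_cst (a^-1) x 1)).
  rewrite scaler0 add0r /= -[_ *: _]/(a^-1 * _) mulrA mulrN mulVf ?gt_eqF// mulN1r opprK.
  by rewrite addrC.
have mf : measurable_fun `]r, +oo[ (fun x : R => (x `^ (- 1 - a))%:E).
  by apply/measurable_EFinP; apply: measurable_funTS; exact: measurable_powR.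
rewrite integral_itv_obnd_cbnd//.
rewrite (@ge0_continuous_FTC2y R _ (fun x => - (x `^ (- a) / a)) r 0)//.
- by rewrite sub0e -EFinN opprK.
- by move=> x _; exact: powR_ge0.
- apply: continuous_in_subspaceT => x /[!inE]/=; rewrite in_itv/= andbT => rx.
  apply/differentiable_continuous/derivable1_diffP.
  by apply: derivable_powR; rewrite in_itv/= (lt_le_trans r0).
- rewrite -oppr0; apply: cvgN; rewrite -(mul0r a^-1).
  apply: cvgM; last exact: cvg_cst.
  apply/cvgrPdist_lt => e e0; near=> x.
  have x0 : 0 < x by near: x; exact: nbhs_pinfty_gt.
  rewrite sub0r normrN ger0_norm ?powR_ge0// powRN.
  rewrite invf_plt ?posrE ?powR_gt0//.
  have e1 : 0 <= e^-1 by rewrite invr_ge0 ltW.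
  have aV : a^-1 * a = 1 by rewrite mulVf ?gt_eqF.
  rewrite -(powRr1 e1) -aV powRrM.
  apply: gt0_ltr_powR => //; rewrite ?nnegrE ?powR_ge0 ?(ltW x0)//.
- by move=> x rx; have ? := D x (lt_trans r0 rx); exact: ex_derive.
- have cr : {for r, continuous (fun x : R => - (x `^ (- a) / a))}.
    apply/differentiable_continuous/derivable1_diffP.
    by have ? := D r r0; exact: ex_derive.
  exact: (@cvg_at_right_filter _ _ _ _ _ cr).
- move=> x; rewrite in_itv/= andbT => rx; have ? := D x (lt_trans r0 rx).
  by rewrite derive1E derive_val.
Unshelve. all: by end_near. Qed.

End power_integrals.

(** * The Gamma function near 0 *)

Section gamma_near0.
Context {R : realType}.
Notation mu := (@lebesgue_measure R).

(** The integral is cut at 1. On ]0, 1], the bounds 1 - u <= e^(-u) <= 1 place it between 1/a - 1/(1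
    + a) and 1/a; the tail lies between 0 and 1. Multiplication by a concludes, since a / (1 + a) <=
    a. *)
Lemma Gamma_near0 (a : R) : 0 < a <= 1 -> 1 - a <= a * Gamma a <= 1 + a.
Proof.
move=> /andP[a0 a1].
pose G (u : R) : R := u `^ (a - 1) * expR (- u).
have G0 u : 0 <= G u by rewrite mulr_ge0 ?powR_ge0 ?expR_ge0.
have mG (D : set R) : measurable_fun D G.
  apply: measurable_funTS; apply: measurable_funM; first exact: measurable_powR.
  by apply: measurableT_comp => //; exact: measurableT_comp.
have mGE D : measurable_fun D (fun x => (G x)%:E) by exact/measurable_EFinP.
pose P (u : R) : R := u `^ (a - 1).
have mP (D : set R) : measurable_fun D P.
  by apply: measurable_funTS; exact: measurable_powR.
have mPE (D : set R) : measurable_fun D (fun x => (P x)%:E) by exact/measurable_EFinP.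
have splitD : `]0, +oo[%classic = `]0%R, 1%R] `|` `]1%R, +oo[%classic :> set R.
  by apply/seteqP; split => x /=; rewrite ?in_itv/= ?andbT; have [|] := lerP x 1 => //=;
    [move=> ? ?; left; rewrite ?in_itv/=; lra|move=> ? ?; right; rewrite ?in_itv/=; lra
    |move=> ? [|]; rewrite ?in_itv/=; lra|move=> ? [|]; rewrite ?in_itv/=; lra].
have GE : (\int[mu]_(u in `]0%R, +oo[) (G u)%:E =
    \int[mu]_(u in `]0%R, 1%R]) (G u)%:E + \int[mu]_(u in `]1%R, +oo[) (G u)%:E)%E.
  rewrite splitD ge0_integral_setU//=.
  - exact: mGE.
  - by move=> *; rewrite lee_fin.
  - by apply/disj_setPS => x /= []; rewrite !in_itv/=; lra.
have I1 : (\int[mu]_(u in `]0%R, 1%R]) (P u)%:E = (a^-1)%:E)%E.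
  by rewrite integral_powR_oc// powR1 mul1r.
have I2 : (\int[mu]_(u in `]0%R, 1%R]) (u `^ a)%:E = (1 + a)^-1%:E)%E.
  have a10 : 0 < a + 1 by lra.
  by have := integral_powR_oc _ _ a10 ltr01; rewrite addrK powR1 mul1r (addrC 1) => ->.
have E1 : (\int[mu]_(u in `]0%R, 1%R]) (G u)%:E <= (a^-1)%:E)%E.
  rewrite -I1; apply: ge0_le_integral => //=.
  - by move=> *; rewrite lee_fin.
  - exact: mGE.
  - exact: mPE.
  - move=> u; rewrite in_itv/= lee_fin => /andP[u0 _].
    by rewrite ler_piMr ?powR_ge0// -expR0 ler_expR oppr_le0 ltW.
have E2 : (\int[mu]_(u in `]1%R, +oo[) (G u)%:E <= 1)%E.
  (* For u > 1 the factor u^(a - 1) is at most 1, so the integrand is below the exponential density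
     of rate 1, of total mass 1. *)
  pose Q := @exponential_pdf R 1.
  have mQ D : measurable_fun D (EFin \o Q).
    by apply: measurable_funTS; apply/measurable_EFinP; exact: measurable_exponential_pdf.
  have Q0 u : 0 <= Q u by exact: exponential_pdf_ge0.
  rewrite -(@integral_exponential_pdf R 1)// -/Q.
  apply: (@le_trans _ _ (\int[mu]_(u in `]1%R, +oo[) (Q u)%:E)%E).
    apply: ge0_le_integral => //=.
    - by move=> *; rewrite lee_fin.
    - exact: mGE.
    - exact: mQ.
    - move=> u; rewrite in_itv/= andbT lee_fin => u1.
      have u0 : 0 <= u by lra.
      rewrite /Q exponential_pdfE// mulN1r mul1r.
      rewrite -[leRHS]mul1r ler_wpM2r ?expR_ge0//.
      by apply: (@le_trans _ _ (u `^ 0)); [apply: ler_powR; lra|rewrite powRr0].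
  by apply: ge0_subset_integral => //=; [exact: mQ|move=> *; rewrite lee_fin].
have E3 : (\int[mu]_(u in `]0%R, 1%R]) (P u)%:E <=
    \int[mu]_(u in `]0%R, 1%R]) (G u)%:E + \int[mu]_(u in `]0%R, 1%R]) (u `^ a)%:E)%E.
  have ma (D : set R) : measurable_fun D (fun u : R => (u `^ a)%:E).
    by apply/measurable_EFinP; apply: measurable_funTS; exact: measurable_powR.
  rewrite -ge0_integralD//=; last 4 first.
  - by move=> *; rewrite lee_fin.
  - exact: mGE.
  - by move=> *; rewrite lee_fin powR_ge0.
  - exact: ma.
  apply: ge0_le_integral => //=.
  - by move=> *; rewrite lee_fin powR_ge0.
  - exact: mPE.
  - by apply: emeasurable_funD; [exact: mGE|exact: ma].
  - move=> u; rewrite in_itv/= => /andP[u0 _].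
    rewrite -EFinD lee_fin /G /P -(mulr_powRB1 (ltW u0) a0) (mulrC u) -mulrDr.
    rewrite ler_peMr ?powR_ge0//.
    by have := expR_ge1Dx (- u); lra.
have E0 : (0 <= \int[mu]_(u in `]0%R, 1%R]) (G u)%:E)%E.
  by apply: integral_ge0 => *; rewrite lee_fin.
have F0 : (0 <= \int[mu]_(u in `]1%R, +oo[) (G u)%:E)%E.
  by apply: integral_ge0 => *; rewrite lee_fin.
rewrite /Gamma /Rintegral GE; move: E0 F0 E1 E2 E3; rewrite I1 I2.
case: (\int[mu]_(u in `]0%R, 1%R]) (G u)%:E)%E => [x| |]//.
case: (\int[mu]_(u in `]1%R, +oo[) (G u)%:E)%E => [y| |]//.
rewrite /= -EFinD !lee_fin => x0 y0 xa y1 ax.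
have aa : a * a^-1 = 1 by rewrite mulfV// gt_eqF.
have xa' : a * x <= 1 by rewrite -aa ler_pM2l.
have ax' : 1 <= a * x + a / (1 + a) by rewrite -[leLHS]aa -mulrDr ler_pM2l.
have aa1 : a / (1 + a) <= a by rewrite ler_pdivrMr ?ler_peMr//; lra.
have ay : a * y <= a by rewrite ler_piMr// ltW.
have ay0 : 0 <= a * y by rewrite mulr_ge0// ltW.
by rewrite mulrDr; apply/andP; split; lra.
Qed.

End gamma_near0.

(** * The Marchaud kernel: near and far parts *)

Section marchaud_kernel.
Context {R : realType}.
Notation mu := (@lebesgue_measure R).
Implicit Types (eta r a w B : R) (g : R -> R).

Definition mker eta (g : R -> R) (tau : R) : R :=
  g tau / `|tau| `^ (1 + eta) * Num.sg tau.

Definition mcst eta : R := eta / (2 * Gamma (1 - eta)).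

(** Evaluated at |tau|, [pnear] is the kernel applied to the identity on |tau| <= r, and [pfar] is
    the absolute value of the kernel beyond r. The exponents are written in the form required by the
    integrals of powers, with parameters 1 - eta and eta. *)
Definition pnear eta r : R -> R := (fun u => u `^ ((1 - eta) - 1)) \_ `]0, r].
Definition pfar eta r : R -> R := (fun u => u `^ (- 1 - eta)) \_ `]r, +oo[.

Lemma measurable_sgr : measurable_fun [set: R] (@Num.sg R).
Proof.
apply: nondecreasing_measurable => // x y xy.
case: (sgrP x) => x0; case: (sgrP y) => y0; lra.
Qed.

Lemma measurable_mker eta g : measurable_fun [set: R] g ->
  measurable_fun [set: R] (mker eta g).
Proof.
move=> mg.
rewrite (_ : mker eta g = fun tau => g tau * `|tau| `^ (- (1 + eta)) * Num.sg tau).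
  apply: measurable_funM; last exact: measurable_sgr.
  apply: measurable_funM => //.
  apply: (@measurableT_comp _ _ _ _ _ _ (fun x : R => x `^ (- (1 + eta)))) => //.
by apply/funext => tau; rewrite powRN.
Qed.

Lemma measurable_pnear eta r : measurable_fun [set: R] (pnear eta r).
Proof.
apply: (measurable_restrictT _ _).1 => //.
by apply: measurable_funTS; exact: measurable_powR.
Qed.

Lemma measurable_pfar eta r : measurable_fun [set: R] (pfar eta r).
Proof.
apply: (measurable_restrictT _ _).1 => //.
by apply: measurable_funTS; exact: measurable_powR.
Qed.

Lemma pnear_ge0 eta r u : 0 <= pnear eta r u.
Proof. by rewrite /pnear /patch; case: ifP => // _; exact: powR_ge0. Qed.

Lemma pfar_ge0 eta r u : 0 <= pfar eta r u.
Proof. by rewrite /pfar /patch; case: ifP => // _; exact: powR_ge0. Qed.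

Lemma integral_pnear eta r : eta < 1 -> 0 < r ->
  (\int[mu]_u (pnear eta r `|u|)%:E = (2 * (r `^ (1 - eta) / (1 - eta)))%:E)%E.
Proof.
move=> eta1 r0; rewrite ge0_integral_norm; last 3 first.
- exact: measurable_pnear.
- by move=> u; exact: pnear_ge0.
- move=> u u0; rewrite /pnear patchE memNset//= in_itv/=.
  by move=> /andP[]; rewrite ltNge u0.
rewrite EFinM -integral_powR_oc// ?subr_gt0//; congr (_ * _)%E.
rewrite [RHS]integral_mkcond; apply: eq_integral => u _.
by rewrite restrict_EFin.
Qed.

Lemma integral_pfar eta r : 0 < eta -> 0 < r ->
  (\int[mu]_u (pfar eta r `|u|)%:E = (2 * (r `^ (- eta) / eta))%:E)%E.
Proof.
move=> eta0 r0; rewrite ge0_integral_norm; last 3 first.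
- exact: measurable_pfar.
- by move=> u; exact: pfar_ge0.
- move=> u u0; rewrite /pfar patchE memNset//= in_itv/= andbT.
  by apply/negP; rewrite -leNgt (le_trans u0)// ltW.
rewrite EFinM -integral_powR_oy//; congr (_ * _)%E.
rewrite [RHS]integral_mkcond; apply: eq_integral => u _.
by rewrite restrict_EFin.
Qed.

Lemma mker_near_far eta r a w B g tau : 0 < r -> 0 <= w ->
  (forall x, `|x| <= r -> `|g x - a * x| <= w * `|x|) ->
  (forall x, `|g x| <= B) ->
  `|mker eta g tau - a * pnear eta r `|tau| | <=
  w * pnear eta r `|tau| + B * pfar eta r `|tau|.
Proof.
move=> r0 w0 gw gB.
have B0 : 0 <= B by rewrite (le_trans _ (gB 0)).
have [->|t0] := eqVneq tau 0.
  rewrite /mker sgr0 mulr0 sub0r normrN /pnear patchE memNset//=; last first.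
    by rewrite in_itv/= normr0 ltxx.
  by rewrite mulr0 normr0 mulr0 add0r mulr_ge0// pfar_ge0.
have t0' : 0 < `|tau| by rewrite normr_gt0.
have [tr|rt] := leP `|tau| r.
  rewrite /pfar (patchE _ _ `|tau|) memNset//=; last first.
    by rewrite in_itv/= andbT; apply/negP; rewrite -leNgt.
  rewrite /pnear patchE mem_set//=; last by rewrite in_itv/= t0'.
  rewrite mulr0 addr0.
  (* Since tau sgn(tau) = |tau|, the linear part of [g] contributes exactly [a * pnear], and only
     the remainder g(tau) - a tau is left to bound. *)
  have -> : `|tau| `^ (1 - eta - 1) = tau * Num.sg tau / `|tau| `^ (1 + eta).
    rewrite (mulrC tau) -normrEsg -[X in X / _](powRr1 (normr_ge0 tau)) -powRB; last first.
      by apply/implyP => _; rewrite gt_eqF.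
    by congr (_ `^ _); lra.
  have -> : mker eta g tau - a * (tau * Num.sg tau / `|tau| `^ (1 + eta)) =
    (g tau - a * tau) * Num.sg tau / `|tau| `^ (1 + eta).
    rewrite /mker; ring.
  rewrite !normrM normrV ?unitfE ?gt_eqF ?powR_gt0// (ger0_norm (powR_ge0 _ _)).
  rewrite normr_sg t0 mulr1 (mulrC tau) -normrEsg mulrA ler_wpM2r ?invr_ge0 ?powR_ge0//.
  exact: gw.
rewrite /pnear patchE memNset//=; last first.
  by rewrite in_itv/= t0'/=; apply/negP; rewrite -ltNge.
rewrite /pfar patchE mem_set//=; last by rewrite in_itv/= rt.
rewrite !mulr0 subr0 add0r (_ : - 1 - eta = - (1 + eta)); last by lra.
rewrite powRN /mker !normrM normrV ?unitfE ?gt_eqF ?powR_gt0// (ger0_norm (powR_ge0 _ _)).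
by rewrite normr_sg t0 mulr1 ler_wpM2r ?invr_ge0 ?powR_ge0.
Qed.

Lemma integrable_pnear eta r : eta < 1 -> 0 < r ->
  mu.-integrable [set: R] (fun u => (pnear eta r `|u|)%:E).
Proof.
move=> eta1 r0; apply/integrableP; split.
  by apply/measurable_EFinP; apply: measurableT_comp => //; exact: measurable_pnear.
under eq_integral do rewrite gee0_abs ?lee_fin ?pnear_ge0//.
by rewrite integral_pnear// ltry.
Qed.

Lemma integrable_pfar eta r : 0 < eta -> 0 < r ->
  mu.-integrable [set: R] (fun u => (pfar eta r `|u|)%:E).
Proof.
move=> eta0 r0; apply/integrableP; split.
  by apply/measurable_EFinP; apply: measurableT_comp => //; exact: measurable_pfar.
under eq_integral do rewrite gee0_abs ?lee_fin ?pfar_ge0//.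
by rewrite integral_pfar// ltry.
Qed.

Lemma integrable_mker eta r a w B g : 0 < eta < 1 -> 0 < r -> 0 <= w ->
  measurable_fun [set: R] g ->
  (forall x, `|x| <= r -> `|g x - a * x| <= w * `|x|) ->
  (forall x, `|g x| <= B) ->
  mu.-integrable [set: R] (EFin \o mker eta g).
Proof.
move=> /andP[eta0 eta1] r0 w0 mg gw gB.
apply: (@le_integrable _ _ _ mu setT measurableT _
  (fun u => ((`|a| + w)%:E * (pnear eta r `|u|)%:E + B%:E * (pfar eta r `|u|)%:E)%E)).
- by apply/measurable_EFinP; exact: measurable_mker.
- move=> x _ /=; rewrite lee_fin [leRHS]ger0_norm; last first.
    rewrite addr_ge0// mulr_ge0 ?addr_ge0 ?pnear_ge0 ?pfar_ge0//.
    by rewrite (le_trans _ (gB 0)).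
  rewrite mulrDl -addrA.
  rewrite -[leLHS](_ : `|(mker eta g x - a * pnear eta r `|x|) + a * pnear eta r `|x| | = _); last first.
    by rewrite subrK.
  rewrite (le_trans (ler_normD _ _))// addrC lerD//.
    exact: mker_near_far.
  by rewrite normrM (ger0_norm (pnear_ge0 _ _ _)).
- apply: integrableD => //; apply: integrableZl => //.
    exact: integrable_pnear.
  exact: integrable_pfar.
Qed.

(** The comparison function is [a * pnear], whose integral is explicit; the pointwise bound
    [mker_near_far] is integrated by [Rintegral_perturb], which supplies the leading 2. *)
Lemma mker_integral_near eta r a w B g : 0 < eta < 1 -> 0 < r -> 0 <= w ->
  (forall x, `|x| <= r -> `|g x - a * x| <= w * `|x|) ->
  (forall x, `|g x| <= B) ->
  `|\int[mu]_u mker eta g u - a * (2 * (r `^ (1 - eta) / (1 - eta)))| <=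
  2 * (w * (2 * (r `^ (1 - eta) / (1 - eta))) + B * (2 * (r `^ (- eta) / eta))).
Proof.
move=> /andP[eta0 eta1] r0 w0 gw gB.
have B0 : 0 <= B by rewrite (le_trans _ (gB 0)).
have In := integrable_pnear _ _ eta1 r0; have If := integrable_pfar _ _ eta0 r0.
pose h (u : R) := (w%:E * (pnear eta r `|u|)%:E + B%:E * (pfar eta r `|u|)%:E)%E.
have Ih : mu.-integrable [set: R] h.
  by apply: integrableD => //; apply: integrableZl.
have hE : (\int[mu]_u h u = (w * (2 * (r `^ (1 - eta) / (1 - eta))) +
    B * (2 * (r `^ (- eta) / eta)))%:E)%E.
  rewrite integralD//; [|exact: integrableZl..].
  by rewrite !integralZl// integral_pnear// integral_pfar// -!EFinM -EFinD.
have -> : a * (2 * (r `^ (1 - eta) / (1 - eta))) = \int[mu]_u (a * pnear eta r `|u|).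
  by rewrite RintegralZl// /Rintegral integral_pnear.
have := @Rintegral_perturb _ _ R mu setT (mker eta g) (fun u => a * pnear eta r `|u|) h measurableT.
rewrite hE /=; apply.
- exact: (integrableZl measurableT a In).
- exact: measurable_int Ih.
- exact: ltry.
- move=> u _; rewrite /h -!EFinM -EFinD lee_fin; exact: mker_near_far.
Qed.

End marchaud_kernel.

(** * The limit of the kernel as eta increases to 1 *)

Section marchaud_limit.
Context {R : realType}.
Notation mu := (@lebesgue_measure R).

Lemma cvg_Gamma_left1 : (1 - eta) * Gamma (1 - eta) @[eta --> (1:R)^'-] --> (1 : R).
Proof.
apply/cvgrPdist_le => e e0; near=> eta.
have eta1 : eta < 1 by near: eta; exact: nbhs_left_lt.
have eta0 : 0 < eta by near: eta; exact: nbhs_left_gt.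
have etae : 1 - e < eta by near: eta; apply: nbhs_left_gt; rewrite ltrBlDr ltrDl.
have := @Gamma_near0 R (1 - eta); rewrite subr_gt0 eta1 lerBlDr lerDl ltW//= => /(_ isT).
by move=> /andP[? ?]; rewrite ler_norml; apply/andP; split; lra.
Unshelve. all: by end_near. Qed.

Lemma cvg_powR_left1 (r : R) (h : R -> R) (l : R) : 0 < r ->
  h x @[x --> (1:R)^'-] --> l -> r `^ (h x) @[x --> (1:R)^'-] --> r `^ l.
Proof.
move=> r0 hl; have r0' : (r == 0) = false by rewrite gt_eqF.
rewrite /powR r0'; have H : h x * ln r @[x --> (1:R)^'-] --> l * ln r by exact: cvgMr_tmp.
exact: (continuous_cvg _ (@continuous_expR R _) H).
Qed.

Lemma cvg_id_left1 : eta @[eta --> (1:R)^'-] --> (1 : R).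
Proof. exact: cvg_at_left_filter. Qed.

Lemma cvg_mcst_near (r : R) : 0 < r ->
  mcst eta * (2 * (r `^ (1 - eta) / (1 - eta))) @[eta --> (1:R)^'-] --> (1 : R).
Proof.
move=> r0.
have H : eta * r `^ (1 - eta) * ((1 - eta) * Gamma (1 - eta))^-1 @[eta --> (1:R)^'-] --> (1 * r `^ (1 - 1) * 1^-1 : R).
  apply: cvgM; last by apply: cvgV; [exact: oner_neq0|exact: cvg_Gamma_left1].
  apply: cvgM; first exact: cvg_id_left1.
  by apply: cvg_powR_left1 => //; apply: cvgB; [exact: cvg_cst|exact: cvg_id_left1].
rewrite subrr powRr0 invr1 !mul1r in H.
apply: cvg_trans H; apply: near_eq_cvg; near=> eta.
rewrite /mcst !invfM; set G := (Gamma _)^-1; set E := (1 - eta)^-1; set P := _ `^ _.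
transitivity (eta * P * (E * G) * (2^-1 * 2)); last ring.
by rewrite mulVf ?mulr1.
Unshelve. all: by end_near. Qed.

Lemma cvg_mcst_far (r : R) : 0 < r ->
  mcst eta * (2 * (r `^ (- eta) / eta)) @[eta --> (1:R)^'-] --> (0 : R).
Proof.
move=> r0.
have H : r `^ (- eta) * (1 - eta) * ((1 - eta) * Gamma (1 - eta))^-1 @[eta --> (1:R)^'-] --> (r `^ (- 1) * (1 - 1) * 1^-1 : R).
  apply: cvgM; last by apply: cvgV; [exact: oner_neq0|exact: cvg_Gamma_left1].
  apply: cvgM.
    by apply: cvg_powR_left1 => //; apply: cvgN; exact: cvg_id_left1.
  by apply: cvgB; [exact: cvg_cst|exact: cvg_id_left1].
rewrite subrr mulr0 mul0r in H.
apply: cvg_trans H; apply: near_eq_cvg; near=> eta.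
have eta1 : 1 - eta != 0.
  by rewrite subr_eq0 gt_eqF//; near: eta; exact: nbhs_left_lt.
have eta0 : eta != 0 by rewrite gt_eqF//; near: eta; exact: nbhs_left_gt.
rewrite /mcst !invfM; set G := (Gamma _)^-1; set P := _ `^ _.
transitivity (P * G * ((1 - eta) / (1 - eta))); first ring.
rewrite mulfV//.
transitivity (P * G * ((2^-1 * 2) * (eta / eta))); last ring.
by rewrite mulVf// mulfV// !mulr1.
Unshelve. all: by end_near. Qed.

(** The order of quantifiers is the point: the neighbourhood of 1 depends on [A], [B], [r], [w]
    only. The same eta then serves the increments of a test function at all base points x at
    once. *)
Lemma mker_limit (A B r w : R) : 0 < r -> 0 < w ->
  \forall eta \near (1:R)^'-, forall (g : R -> R) (a : R), `|a| <= A ->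
    (forall x : R, `|x| <= r -> `|g x - a * x| <= w * `|x|) ->
    (forall x, `|g x| <= B) ->
    `|mcst eta * \int[mu]_u mker eta g u - a| <= 4 * w.
Proof.
move=> r0 w0.
pose T eta := mcst eta * (2 * (r `^ (1 - eta) / (1 - eta))).
pose S eta := mcst eta * (2 * (r `^ (- eta) / eta)).
have H : A * `|T eta - 1| + 2 * (w * T eta + B * S eta) @[eta --> (1:R)^'-] -->
    (A * `|1 - 1| + 2 * (w * 1 + B * 0) : R).
  have cT : T eta @[eta --> (1:R)^'-] --> (1:R) by exact: cvg_mcst_near.
  apply: cvgD; apply: cvgMl_tmp.
    by apply: cvg_norm; apply: cvgB => //; exact: cvg_cst.
  by apply: cvgD; apply: cvgMl_tmp => //; exact: cvg_mcst_far.
(* The error bound tends to 2 w, so it is eventually below 4 w. *)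
rewrite subrr normr0 !mulr0 add0r addr0 mulr1 in H.
near=> eta => g a aA gw gB.
have eta1 : eta < 1 by near: eta; exact: nbhs_left_lt.
have eta0 : 0 < eta by near: eta; exact: nbhs_left_gt.
have eta01 : 0 < eta < 1 by rewrite eta0.
have Hn : A * `|T eta - 1| + 2 * (w * T eta + B * S eta) < 4 * w.
  by near: eta; apply: (cvgr_lt _ H); lra.
have C0 : 0 <= mcst eta.
  rewrite /mcst; apply: divr_ge0; [exact: ltW|apply: mulr_ge0 => //].
  by apply: Rintegral_ge0 => x _; rewrite mulr_ge0 ?powR_ge0 ?expR_ge0.
have := mker_integral_near _ _ _ _ _ _ eta01 r0 (ltW w0) gw gB.
move=> /(ler_wpM2l C0); rewrite -[X in X * `|_|](ger0_norm C0) -normrM mulrBr.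
rewrite (mulrCA _ a) -/(T eta) (mulrCA _ 2) mulrDr (mulrCA _ w) (mulrCA _ B).
rewrite -/(T eta) -/(S eta); set I := mcst eta * _ => HI.
have -> : I - a = (I - a * T eta) + a * (T eta - 1) by ring.
rewrite (le_trans (ler_normD _ _))// normrM addrC.
by rewrite (le_trans _ (ltW Hn))// lerD// ler_wpM2r.
Unshelve. all: by end_near. Qed.

(** An absolutely convergent kernel integral needs no principal value. At tau = 0 the integrand is 0
    because [Num.sg 0] is. *)
Lemma marchaudE (eta x : R) (g : R -> R) :
  mu.-integrable [set: R] (EFin \o mker eta (fun tau => g (x + tau) - g x)) ->
  marchaud eta g x =
    mcst eta * \int[mu]_u mker eta (fun tau => g (x + tau) - g x) u.
Proof.
move=> ik; apply/cvg_lim => //; apply: cvgMl_tmp.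
by apply: cvg_punctured_integral => //; rewrite /mker sgr0 mulr0.
Qed.

End marchaud_limit.

(** * The substitution u = sqrt v *)

Section sqrt_change_of_variables.
Context {R : realType}.
Notation mu := (@lebesgue_measure R).

(* Adding to M the restriction of mu to the negative half line reduces the claim
   to the uniqueness of Lebesgue measure on the line. *)
Lemma lebesgue_measure_unique_pos (M : {measure set (measurableTypeR R) -> \bar R}) :
  M (`]-oo, 0]%classic : set R) = 0%E ->
  (forall a b : R, 0 <= a -> a < b -> M (`]a, b]%classic : set R) = (b - a)%:E) ->
  forall A : set R, measurable A -> A `<=` `]0, +oo[ -> M A = mu A.
Proof.
move=> M0 Mab A mA A0.
pose D : set R := `]-oo, 0]%classic.
have mD : measurable (D : set (measurableTypeR R)) by exact: measurable_itv.
have M0' (B : set R) : measurable B -> B `<=` D -> M B = 0%E.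
  move=> mB BD; apply/eqP; rewrite eq_le measure_ge0 andbT -M0.
  by apply: le_measure => //; rewrite inE.
have muS a b : mu (`]a, b]%classic `&` D) = mu `]a, Num.min b 0]%classic.
  congr (mu _); apply/seteqP; split => x /=; rewrite /D/= !in_itv/= le_min.
    by move=> [/andP[-> ->]].
  by move=> /and3P[-> -> ->].
have -> : mu A = measure_add M (mrestr mu mD) A.
  apply: lebesgue_measure_unique => // _ [[a b]] _ <-.
  rewrite [RHS]measure_addE [X in (_ + X)%E]muS /= !lebesgue_measure_itv/= !lte_fin.
  have [ab|ba] := ltP a b; last first.
    rewrite set_itv_ge ?measure0 ?add0e; last by rewrite bnd_simp -leNgt.
    by rewrite ifF//; apply/negbTE; rewrite -leNgt ge_min ba.
  have [b0|b0] := leP b 0.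
    rewrite M0' ?add0e ?ab// => x /=; rewrite /D/= !in_itv/= => /andP[_ xb].
    exact: le_trans b0.
  have [a0|a0] := leP 0 a.
    by rewrite adde0 Mab// EFinB.
  have -> : `]a, b]%classic = `]a, 0] `|` `]0, b] :> set R.
    apply/seteqP; split => x /=; rewrite !in_itv/=.
      move=> /andP[ax xb]; have [x0|x0] := leP x 0; [left|right].
        by rewrite ax.
      by rewrite xb.
    by move=> [|] /andP[? ?]; apply/andP; split; lra.
  have -> : M (`]a, 0] `|` `]0, b]) = (M (`]a, 0%R]%classic : set R) + M (`]0%R, b]%classic : set R))%E.
    apply: measureU => //.
    by apply/seteqP; split => x //= [] /=; rewrite !in_itv/= => /andP[_ x0] /andP[+ _]; rewrite ltNge x0.
  have -> : M (`]a, 0%R]%classic : set R) = 0%E.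
    by apply: M0' => // x /=; rewrite /D/= !in_itv/= => /andP[_ ->].
  rewrite Mab//.
  by rewrite add0e -!EFinD; congr EFin; lra.
have AD : A `&` D = set0.
  by apply/seteqP; split => x //= [/A0]/=; rewrite /D/= !in_itv/= andbT ltNge => /negP.
rewrite [RHS]measure_addE [X in (_ + X)%E](_ : _ = 0%E) ?adde0//.
by transitivity (mu (A `&` D)) => //; rewrite AD measure0.
Qed.

(* The derivative of the square root on the positive half line, and 0 on the
   negative one since Num.sqrt and the inverse vanish there. *)
Definition dsqrt (v : R) : R := (2 * Num.sqrt v)^-1.

Lemma dsqrt_ge0 v : 0 <= dsqrt v.
Proof. by rewrite invr_ge0 mulr_ge0 ?sqrtr_ge0. Qed.

Lemma dsqrt_npos v : v <= 0 -> dsqrt v = 0.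
Proof. by move=> v0; rewrite /dsqrt ler0_sqrtr// mulr0 invr0. Qed.

Lemma measurable_sqrt : measurable_fun [set: R] (@Num.sqrt R).
Proof. by apply: nondecreasing_measurable => // x y xy; rewrite ler_wsqrtr. Qed.

Lemma measurable_dsqrt : measurable_fun [set: R] dsqrt.
Proof.
rewrite (_ : dsqrt = (fun v => 2^-1 * v `^ (- 2^-1)) \_ `]0, +oo[).
  apply: (measurable_restrictT _ _).1 => //; apply: measurable_funTS.
  by apply: measurable_funM => //; exact: measurable_powR.
apply/funext => v; have [v0|v0] := leP v 0.
  rewrite dsqrt_npos// patchE memNset//= in_itv/= andbT.
  by apply/negP; rewrite -leNgt.
rewrite patchE mem_set/= ?in_itv/= ?v0// powRN powR12_sqrt ?ltW//.
by rewrite /dsqrt invfM.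
Qed.

Lemma integral_dsqrt_oc (a b : R) : 0 <= a -> a < b ->
  (\int[mu]_(v in `](a ^+ 2)%R, (b ^+ 2)%R]) (dsqrt v)%:E = (b - a)%:E)%E.
Proof.
move=> a0 ab; have b0 : 0 <= b by lra.
rewrite (@ge0_FTC2_oc R dsqrt Num.sqrt (a ^+ 2) (b ^+ 2)).
- by rewrite !sqrtr_sqr !ger0_norm.
- by rewrite ltr_pXn2r ?nnegrE.
- by move=> x _; exact: dsqrt_ge0.
- move=> x ax; have x0 : 0 < x by rewrite (le_lt_trans _ ax)// sqr_ge0.
  apply: continuousV; first by rewrite mulf_neq0// gt_eqF// sqrtr_gt0.
  by apply: continuousM; [exact: cst_continuous|exact: sqrt_continuous].
- move=> x ax; have x0 : 0 < x by rewrite (le_lt_trans _ ax)// sqr_ge0.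
  by have ? := is_derive1_sqrt x0; exact: ex_derive.
- move=> x ax; have x0 : 0 < x by rewrite (le_lt_trans _ ax)// sqr_ge0.
  by have ? := is_derive1_sqrt x0; rewrite derive1E derive_val.
- by apply: cvg_at_right_filter; exact: sqrt_continuous.
Qed.

(** The image under the square root of the measure with density [dsqrt] is Lebesgue measure on the
    positive half line: the preimage of ]a, b] is ]a^2, b^2], whose mass is b - a. *)
Lemma ge0_integral_sqrt (g : R -> \bar R) :
  measurable_fun [set: R] g -> (forall x, 0 <= g x)%E ->
  (\int[mu]_v (g (Num.sqrt v) * (dsqrt v)%:E) = \int[mu]_(u in `]0%R, +oo[) g u)%E.
Proof.
move=> mg g0.
pose nu : {measure set (measurableTypeR R) -> \bar R} :=
  @density _ _ R mu dsqrt measurable_dsqrt dsqrt_ge0.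
pose sq : measurableTypeR R -> measurableTypeR R := Num.sqrt.
pose D : set R := `]0, +oo[%classic.
have mD : measurable D by exact: measurable_itv.
have msq : measurable_fun [set: R] sq by exact: measurable_sqrt.
have mg' : measurable_fun [set: R] ((g \o sq) \_ D).
  apply: (measurable_restrictT _ mD).1; apply: measurable_funTS.
  exact: measurableT_comp.
have sqrtD : sq @^-1` D = D.
  by apply/seteqP; split => x /=; rewrite /D/= !in_itv/= !andbT sqrtr_gt0.
have E : forall A : set R, measurable A -> A `<=` D -> pushforward nu sq A = mu A.
  apply: lebesgue_measure_unique_pos => [|a b a0 ab].
  - transitivity (\int[mu]_(v in sq @^-1` `]-oo, 0%R]) (dsqrt v)%:E)%E => //.
    rewrite integral0_eq// => v /=.
    rewrite /sq in_itv/= => v0; rewrite dsqrt_npos//.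
    by move: v0; rewrite leNgt sqrtr_gt0 -leNgt.
  - transitivity (\int[mu]_(v in sq @^-1` `]a, b]) (dsqrt v)%:E)%E => //.
    rewrite -(integral_dsqrt_oc a b)//; congr (integral _ _ _).
    apply/seteqP; split => v /=; rewrite /sq !in_itv/=; have [v0|v0] := leP v 0.
    + by rewrite ler0_sqrtr// ltNge a0.
    + have s0 : 0 <= Num.sqrt v by exact: sqrtr_ge0.
      rewrite -{3 4}(sqr_sqrtr (ltW v0)) => /andP[? ?].
      by rewrite ltr_pXn2r ?ler_pXn2r ?nnegrE//; [apply/andP|lra].
    + by rewrite ltNge (le_trans v0)// sqr_ge0.
    + have s0 : 0 <= Num.sqrt v by exact: sqrtr_ge0.
      rewrite -{1 2}(sqr_sqrtr (ltW v0)).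
      by rewrite ltr_pXn2r ?ler_pXn2r ?nnegrE//; lra.
transitivity (\int[pushforward nu sq]_(x in D) g x)%E; last first.
  by apply: eq_measure_integral => A mA AD; exact: E.
rewrite ge0_integral_pushforward//; last exact: measurable_funTS.
rewrite sqrtD integral_mkcond integral_density//; last first.
  by move=> x; apply: erestrict_ge0 => y _; exact: g0.
apply: eq_integral => v _; rewrite patchE; case: ifPn => //.
rewrite notin_setE/= /D/= in_itv/= andbT => /negP; rewrite -leNgt => v0.
by rewrite dsqrt_npos// !mule0.
Qed.

End sqrt_change_of_variables.

(** * The transfer operator as the action on densities *)

Section transfer_operator.
Context {R : realType}.
Notation mu := (@lebesgue_measure R).
Implicit Types (t s x y : R) (rho : R -> R).

(** In the variable v = t - x the cut-off x < t is absorbed by [dsqrt], which vanishes for v <= 0;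
    no case distinction remains. *)
Lemma transfer_dsqrt t rho v :
  transfer t rho (t - v) = (rho (Num.sqrt v) + rho (- Num.sqrt v)) * dsqrt v.
Proof.
rewrite /transfer -[X in _ < X]subr0 ltrD2l ltrN2 subKr; case: ltP => // v0.
by rewrite dsqrt_npos// mulr0.
Qed.

Lemma transfer_shift s t rho y : transfer s rho y = transfer t rho (y - (s - t)).
Proof.
rewrite /transfer (_ : t - (y - (s - t)) = s - y); last by ring.
by rewrite (_ : (y - (s - t) < t) = (y < s))//; apply/idP/idP; lra.
Qed.

Lemma transfer_ge0 t rho x : (forall y, 0 <= rho y) -> 0 <= transfer t rho x.
Proof.
move=> rho0; rewrite /transfer; case: ifP => // _.
by rewrite divr_ge0 ?addr_ge0 ?mulr_ge0 ?sqrtr_ge0.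
Qed.

Lemma measurable_transfer t rho : measurable_fun [set: R] rho ->
  measurable_fun [set: R] (transfer t rho).
Proof.
move=> mrho; rewrite (_ : transfer t rho =
    (fun v => (rho (Num.sqrt v) + rho (- Num.sqrt v)) * dsqrt v) \o (fun y => t - y)).
  have ms := @measurable_sqrt R.
  apply: measurableT_comp; last exact: measurable_funB.
  apply: measurable_funM; last exact: measurable_dsqrt.
  apply: measurable_funD; first exact: measurableT_comp.
  by apply: measurableT_comp => //; exact: measurableT_comp.
by apply/funext => y; rewrite /= -(transfer_dsqrt t) subKr.
Qed.

Lemma measurable_quad t : measurable_fun [set: R] (quad t).
Proof. by apply: measurable_funB => //; exact: measurable_funX. Qed.

(** With y = t - v, the two branches sqrt v and -sqrt v of the inverse of [quad t] sweep out the two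
    open half lines, and the substitution u = sqrt v turns [dsqrt v dv] into [du]. *)
Lemma integral_transfer t rho (A : set R) : measurable_fun [set: R] rho ->
  (forall y, 0 <= rho y) -> measurable A ->
  (\int[mu]_(y in A) (transfer t rho y)%:E =
   \int[mu]_(x in quad t @^-1` A) (rho x)%:E)%E.
Proof.
move=> mrho rho0 mA.
have mB : measurable (quad t @^-1` A).
  by rewrite -[X in measurable X]setTI; exact: measurable_quad.
pose h (u : R) : \bar R := ((EFin \o rho) \_ (quad t @^-1` A)) u.
have mh : measurable_fun [set: R] h.
  apply: (measurable_restrictT _ mB).1; apply: measurable_funTS; exact/measurable_EFinP.
have h0 u : (0 <= h u)%E by apply: erestrict_ge0 => y _; rewrite lee_fin.
pose T (y : R) : \bar R := ((EFin \o transfer t rho) \_ A) y.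
have mT : measurable_fun [set: R] T.
  apply: (measurable_restrictT _ mA).1; apply: measurable_funTS.
  by apply/measurable_EFinP; exact: measurable_transfer.
have T0 u : (0 <= T u)%E by apply: erestrict_ge0 => y _; rewrite lee_fin transfer_ge0.
rewrite integral_mkcond [RHS]integral_mkcond -/h -/T.
pose D : set R := `]0, +oo[%classic.
have mD : measurable D by exact: measurable_itv.
have mhN : measurable_fun [set: R] (fun u => h (- u)) by exact: measurableT_comp.
transitivity (\int[mu]_v ((h (Num.sqrt v) + h (- Num.sqrt v)%R) * (dsqrt v)%:E))%E.
  rewrite -(ge0_integral_shift t _ mT T0).
  have mTt : measurable_fun [set: R] (fun y : R => T (y + t)).
    by apply: (measurableT_comp mT); exact: measurable_funD.
  rewrite -(ge0_integral_opp _ mTt)//.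
  apply: eq_integral => v _; rewrite [- v + t]addrC /T /h /patch.
  have [v0|v0] := leP v 0.
    by rewrite dsqrt_npos// mule0; case: ifP => // _; rewrite /= transfer_dsqrt dsqrt_npos// mulr0.
  (* Both preimages of t - v enter the restriction to the preimage of [A] together, exactly when t -
     v is in [A]. *)
  have E (e : R) : e ^+ 2 = v -> (e \in quad t @^-1` A) = (t - v \in A).
    by move=> ev; apply/idP/idP; rewrite !inE /= /quad ev.
  rewrite !E ?sqrrN ?sqr_sqrtr ?ltW//; case: ifP => _; last by rewrite adde0 mul0e.
  by rewrite /= transfer_dsqrt EFinM EFinD.
rewrite (ge0_integral_sqrt (fun u => h u + h (- u)%R)%E); last 2 first.
- exact: emeasurable_funD.
- by move=> x; exact: adde_ge0.
rewrite ge0_integralD//; last 2 first.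
- exact: measurable_funTS.
- exact: measurable_funTS.
pose N : set R := `]-oo, 0[%classic.
have mN : measurable N by exact: measurable_itv.
have -> : (\int[mu]_(u in `]0%R, +oo[) h (- u)%R = \int[mu]_(u in N) h u)%E.
  rewrite integral_mkcond [RHS]integral_mkcond -(ge0_integral_opp (h \_ N)).
  - apply: eq_integral => u _; rewrite /patch; congr (if _ then _ else _).
    by apply/idP/idP; rewrite !inE /N/= !in_itv/= andbT oppr_lt0.
  - by apply: (measurable_restrictT _ mN).1; exact: measurable_funTS.
  - by move=> u; apply: erestrict_ge0.
rewrite -ge0_integral_setU//; last 2 first.
- exact: measurable_funTS.
- apply/disj_setPS => u []; rewrite /N/= !in_itv/= andbT => u0.
  by rewrite ltNge (ltW u0).
have <- : [set: R] `\ 0 = `]0, +oo[ `|` N.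
  apply/seteqP; split => u /=; rewrite /N/= !in_itv/= andbT.
    by move=> [_ /eqP]; rewrite neq_lt => /orP[|] u0; [right|left].
  by move=> u0; split => // u00; move: u0; rewrite u00 ltxx => -[].
rewrite integral_setD1//.
- by apply: measurableD.
- exact: measurable_funTS.
Qed.

End transfer_operator.

(** * Consequences of invariance and of the support condition *)

Section acip.
Context {R : realType} (t : R) (nu : probability (measurableTypeR R) R).
Context (rho : R -> R) (rho_acip : acip_density t nu rho).
Notation mu := (@lebesgue_measure R).

Let mrho : measurable_fun [set: R] rho := acip_measurable rho_acip.
Let rho0 x : 0 <= rho x := acip_ge0 rho_acip x.

Definition primitive_from (f : R -> R) (x : R) : R := \int[mu]_(y in `]-oo, x]) f y.

Lemma acip_integral1 : (\int[mu]_x (rho x)%:E = 1)%E.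
Proof. by rewrite -(acip_density_eq rho_acip)// probability_setT. Qed.

Lemma acip_integrable : mu.-integrable [set: R] (EFin \o rho).
Proof.
apply/integrableP; split; first exact/measurable_EFinP.
under eq_integral do rewrite gee0_abs ?lee_fin ?rho0//.
by rewrite acip_integral1 ltry.
Qed.

(** Invariance of the measure, read on densities in integrated form; no pointwise or almost
    everywhere identity between [transfer t rho] and [rho] has to be extracted. *)
Lemma acip_transfer (A : set R) : measurable A ->
  (\int[mu]_(y in A) (transfer t rho y)%:E = \int[mu]_(y in A) (rho y)%:E)%E.
Proof.
move=> mA; rewrite integral_transfer// -!(acip_density_eq rho_acip)//.
  exact: (acip_invariant rho_acip).
by rewrite -[X in measurable X]setTI; exact: measurable_quad.
Qed.

(** Exact for every [s] and [x]: each member of the extended family is still a translate of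
    [quad t], by the clamped displacement. *)
Lemma acip_cumul eps s x :
  cumul t eps rho s x = primitive_from rho (x - (clamp t eps s - t)).
Proof.
rewrite /cumul /primitive_from /Rintegral -acip_transfer//; congr fine.
rewrite integral_mkcond [RHS]integral_mkcond.
rewrite -[RHS](ge0_integral_shift (- (clamp t eps s - t))).
- apply: eq_integral => y _; rewrite /patch /transfer_ext/= -(transfer_shift _ t).
  congr (if _ then _ else _).
  by apply/idP/idP; rewrite !inE /= !in_itv/= lerD2r.
- apply: (measurable_restrictT _ _).1 => //; apply: measurable_funTS.
  by apply/measurable_EFinP; exact: measurable_transfer.
- by move=> y; apply: erestrict_ge0 => z _; rewrite lee_fin transfer_ge0.
Qed.

(** A Lindelof argument: a point outside the support lies in an interval with rational endpoints on
    which [rho] vanishes almost everywhere, and there are countably many such intervals. *)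
Lemma acip_ae0 (C : set R) : `[crit t 2, crit t 1]%classic `<=` C ->
  {ae mu, forall x, ~ C x -> rho x = 0}.
Proof.
move=> cC.
pose good (p : rat * rat) := {ae mu, forall y, `]ratr p.1, ratr p.2[%classic y -> rho y = 0}.
(* The exceptional set of the n-th rational interval, empty when n codes no interval or when [rho]
   is not almost everywhere zero on it. *)
pose F n : set R := if unpickle n is Some p then
  if `[< good p >] then [set y | ~ (`]ratr p.1, ratr p.2[%classic y -> rho y = 0)] else set0
  else set0.
have NF : mu.-negligible (\bigcup_n F n).
  apply: negligible_bigcup => n; rewrite /F; case: unpickle => [p|]; last exact: negligible_set0.
  by case: ifPn => [/asboolP|_]; [|exact: negligible_set0].
apply: negligibleS NF => x /=.
move=> /not_implyP[Cx rx].
have : ~ ess_supp rho x by rewrite (acip_supp rho_acip) => /cC.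
move=> /existsNP[U] /not_implyP[[oU Ux]] /contrapT Uae.
have /nbhs_ballP[e /= e0 eU] : nbhs x U by exact: open_nbhs_nbhs.
have xe : x - e < x by rewrite gtrBl.
have xe' : x < x + e by rewrite ltrDl.
have [q] := rat_in_itvoo xe; rewrite in_itv/= => /andP[qe qx].
have [r] := rat_in_itvoo xe'; rewrite in_itv/= => /andP[xr re].
have [n nE] : exists n, unpickle n = Some (q, r).
  by exists (pickle (q, r)); exact: pickleK.
exists n; first exact: I.
rewrite /F nE.
have g : good (q, r).
  apply: negligibleS Uae => y /= + Uy; apply; rewrite in_itv/= => /andP[qy yr]; apply: Uy.
  by apply: eU; rewrite /ball/= ltr_norml; apply/andP; split; lra.
rewrite asboolT//=; apply/not_implyP; split => //.
by rewrite in_itv/= qx xr.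
Qed.

End acip.

(** * Test functions and their composition with iterates *)

Section bounded_support.
Context {R : realType}.
Implicit Types (f psi : R -> R) (t : R).

(** A closure-free form of compact support. The strict inequality defines an open set, so the
    property passes to the derivative. *)
Definition bounded_support f := exists M : R, forall x : R, M < `|x| -> f x = 0.

Definition C1_bounded_support psi :=
  [/\ forall x, derivable psi x 1, continuous (derive1 psi) & bounded_support psi].

Lemma bounded_support_bounded f : continuous f -> bounded_support f ->
  exists B : R, forall x : R, `|f x| <= B.
Proof.
move=> cf [M fM].
have [||c _ fc] := @EVT_max R (fun x => `|f x|) (- `|M|) `|M|.
- by rewrite (@le_trans _ _ 0)// oppr_le0.
- apply: continuous_subspaceT => x; apply: continuous_comp; first exact: cf.
  exact: norm_continuous.
exists `|f c| => x; have [xM|Mx] := leP `|x| `|M|.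
  by apply: fc; rewrite in_itv/= -ler_norml.
by rewrite fM ?normr0// (le_lt_trans _ Mx)// ler_norm.
Qed.

Lemma bounded_support_derive f : bounded_support f -> bounded_support (derive1 f).
Proof.
move=> [M fM]; exists M => x Mx; rewrite derive1E -(derive_cst (0:R) x (1:R)).
apply: near_eq_derive; near=> y; apply: fM; near: y.
by apply: (cvgr_gt _ (@norm_continuous _ R x)).
Unshelve. all: by end_near. Qed.

Lemma bounded_support_unif_continuous f : continuous f -> bounded_support f ->
  forall w : R, 0 < w -> exists2 r : R, 0 < r & forall x h : R, `|h| <= r -> `|f (x + h) - f x| <= w.
Proof.
move=> cf [M fM] w w0.
(* The margin 1 matches the later restriction |h| <= 1: if |x| > N, both x and x + h are beyond
   [M]. *)
pose N : R := `|M| + 1.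
pose P (r x : R) := forall h, `|h| <= r -> `|f (x + h) - f x| <= w.
have /compact_near_coveringP/(_ R (0:R)^'+ P _) : compact `[- N, N]%classic.
  exact: segment_compact.
move=> [|r0 /= r00 H].
  move=> x _.
  have w20 : 0 < w / 2 by rewrite divr_gt0.
  have /cvgrPdist_le/(_ _ w20)/nbhs_ballP[d /= d0 dx] := cf x.
  have d20 : 0 < d / 2 by rewrite divr_gt0.
  exists (ball x (d / 2), [set r | r < d / 2]); first split => /=.
  - exact: nbhsx_ballx.
  - exact: nbhs_right_lt.
  - move=> [y r]/= [yx rd] h hr.
    rewrite -[X in `|X|](_ : (f x - f y) - (f x - f (y + h)) = _); last by ring.
    rewrite (le_trans (ler_normB _ _))// [leRHS]splitr lerD// dx//.
      by apply: le_ball yx; lra.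
    rewrite /ball/= opprD addrA (le_lt_trans (ler_normB _ _))//.
    by move: yx; rewrite /ball/=; lra.
have r2 : 0 < r0 / 2 by rewrite divr_gt0.
exists (Num.min (r0 / 2) 1); first by rewrite lt_min r2/=.
move=> x h; rewrite le_min => /andP[hr h1].
have [xN|Nx] := leP `|x| N.
  apply: (H (r0 / 2)) => //=; last by rewrite in_itv/= -ler_norml.
  by rewrite /ball/= sub0r normrN gtr0_norm//; lra.
have M1 := ler_norm M.
have := ler_normB (x + h) h; rewrite addrK => xh.
by rewrite /N in Nx; rewrite !fM ?subrr ?normr0 ?(ltW w0)//; lra.
Qed.

(** By the mean value theorem the difference quotient is the derivative at a point within |h| of x,
    and the derivative is uniformly continuous. *)
Lemma C1_bounded_support_unif_derivable psi : C1_bounded_support psi ->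
  forall w : R, 0 < w -> exists2 r : R, 0 < r &
    forall x h : R, `|h| <= r -> `|psi (x + h) - psi x - derive1 psi x * h| <= w * `|h|.
Proof.
move=> [dpsi cpsi bpsi] w w0.
have [r r0 H] := bounded_support_unif_continuous _ cpsi (bounded_support_derive _ bpsi) _ w0.
have D (x : R) : is_derive x 1 psi (derive1 psi x).
  by rewrite derive1E; apply/derivableP.
have cont (A : set R) : {within A, continuous psi}.
  apply: continuous_subspaceT => x.
  exact/differentiable_continuous/derivable1_diffP.
exists r => // x h hr.
have [h0|h0] := leP 0 h.
  have [||c] := @MVT_segment R psi (derive1 psi) x (x + h); rewrite ?lerDl//.
  rewrite in_itv/= => /andP[xc cx] ->.
  rewrite addrAC subrr add0r -mulrBl normrM ler_wpM2r//.
  rewrite -[c](subrKC x); apply: H; rewrite (le_trans _ hr)//.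
  by rewrite !ger0_norm//; lra.
have [||c] := @MVT_segment R psi (derive1 psi) (x + h) x; rewrite ?gerDl ?(ltW h0)//.
rewrite in_itv/= => /andP[xc cx] E.
rewrite -[X in X - _ * _]opprB E opprD addrA subrr add0r mulrN opprK -mulrBl normrM ler_wpM2r//.
rewrite -[c](subrKC x); apply: H; rewrite (le_trans _ hr)//.
by rewrite !ler0_norm//; lra.
Qed.

Lemma C1_bounded_support_quad t psi : C1_bounded_support psi ->
  C1_bounded_support (psi \o quad t).
Proof.
move=> [dpsi cpsi [M psiM]].
have dq (x : R) : is_derive x 1 (quad t) (- (2 * x)).
  rewrite /quad; apply: is_derive_eq.
  by rewrite -[x%:A]/(x * 1); ring.
have E : derive1 (psi \o quad t) = fun x : R => derive1 psi (quad t x) * - (2 * x).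
  apply/funext => x; rewrite derive1_comp//.
  by congr (_ * _); rewrite derive1E derive_val.
have cq : continuous (quad t).
  by move=> x; apply/differentiable_continuous/derivable1_diffP; exact: ex_derive.
split.
- move=> x; apply/derivable1_diffP; apply: differentiable_comp; apply/derivable1_diffP.
    exact: ex_derive.
  exact: dpsi.
- have c1 : continuous (derive1 psi \o quad t).
    by move=> x; apply: continuous_comp; [exact: cq|exact: cpsi].
  have c2 : continuous (fun x : R => - (2 * x)).
    by move=> x; apply: cvgN; apply: cvgM; [exact: cvg_cst|exact: cvg_id].
  by rewrite E => x; exact: cvgM (c1 x) (c2 x).
(* Beyond this bound |x| > 1, hence x^2 >= |x| and |t - x^2| >= x^2 - |t| > |M|. *)
- exists (`|M| + `|t| + 1) => x Mx /=; apply: psiM.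
  have M1 := ler_norm M; have M0 := normr_ge0 M; have t0 := normr_ge0 t.
  have : `|x| ^+ 2 - `|t| <= `|quad t x|.
    by rewrite -normrX /quad (distrC t); exact: lerB_dist.
  by nra.
Qed.

Lemma C1_compact_support_bounded psi : C1_compact_support psi ->
  C1_bounded_support psi.
Proof.
move=> [dpsi cpsi cpt]; split; [exact: dpsi|exact: cpsi|].
have [M [_ MA]] := compact_bounded cpt.
exists (M + 1) => x Mx; apply/eqP/negPn/negP => px0.
have := MA (M + 1) ltac:(by rewrite ltrDl) x.
by move=> /(_ (@subset_closure _ _ x px0)) /=; rewrite leNgt Mx.
Qed.

Lemma C1_bounded_support_iter t psi k : C1_bounded_support psi ->
  C1_bounded_support (psi \o iter k (quad t)).
Proof.
elim: k psi => [|k IH] psi Hpsi //.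
(* [iter] applies its last map outermost; that map is absorbed into the test function, so the
   induction runs over all [psi]. *)
rewrite (_ : _ \o _ = (psi \o quad t) \o iter k (quad t))//.
by apply: IH; exact: C1_bounded_support_quad.
Qed.

End bounded_support.

(** * The response side *)

Section response.
Context {R : realType}.
Notation mu := (@lebesgue_measure R).
Implicit Types psi rho f : R -> R.

Lemma C1_bounded_support_continuous psi : C1_bounded_support psi -> continuous psi.
Proof.
by move=> [dpsi _ _] x; exact/differentiable_continuous/derivable1_diffP.
Qed.

Lemma C1_bounded_support_bounds psi : C1_bounded_support psi ->
  exists B K : R, (forall x, `|psi x| <= B) /\ (forall x, `|derive1 psi x| <= K).
Proof.
move=> Hpsi; have [_ cpsi bpsi] := Hpsi.
have [B HB] := bounded_support_bounded _ (C1_bounded_support_continuous _ Hpsi) bpsi.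
have [K HK] := bounded_support_bounded _ cpsi (bounded_support_derive _ bpsi).
by exists B, K.
Qed.

Lemma marchaud_cvg_unif psi : C1_bounded_support psi ->
  forall w : R, 0 < w ->
    \forall eta \near (1:R)^'-, forall x, `|marchaud eta psi x - derive1 psi x| <= w.
Proof.
move=> Hpsi w w0; have [B [K [HB HK]]] := C1_bounded_support_bounds _ Hpsi.
have w4 : 0 < w / 4 by rewrite divr_gt0.
have [r r0 Hr] := C1_bounded_support_unif_derivable _ Hpsi _ w4.
have HB2 (x tau : R) : `|psi (x + tau) - psi x| <= 2 * B.
  rewrite (le_trans (ler_normB _ _))//.
  by have := HB x; have := HB (x + tau); lra.
near=> eta => x.
have eta1 : eta < 1 by near: eta; exact: nbhs_left_lt.
have eta0 : 0 < eta by near: eta; exact: nbhs_left_gt.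
have mg : measurable_fun [set: R] (fun tau => psi (x + tau) - psi x).
  apply: measurable_funB => //; apply: measurableT_comp => //.
    by apply: continuous_measurable_fun; exact: C1_bounded_support_continuous.
  exact: measurable_funD.
rewrite marchaudE; last first.
  apply: (integrable_mker _ _ _ _ _ _ _ r0 (ltW w4) mg (Hr x) (HB2 x)).
  by rewrite eta0.
rewrite (le_trans (_ : _ <= 4 * (w / 4)))//; last by lra.
move: x {mg}; near: eta.
apply: filterS (mker_limit K (2 * B) _ _ r0 w4) => eta H x.
by apply: H => //; exact: Hr.
Unshelve. all: by end_near. Qed.

Lemma integrable_mul_bounded rho f (K : R) (D : set R) : measurable D ->
  mu.-integrable D (EFin \o rho) -> measurable_fun D f ->
  (forall x, `|f x| <= K) -> mu.-integrable D (EFin \o (fun x => f x * rho x)).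
Proof.
move=> mD irho mf fK; have mrho := measurable_int _ irho.
have K0 : 0 <= K by rewrite (le_trans _ (fK 0)).
apply: (@le_integrable _ _ _ mu D mD _ (fun x => K%:E * (rho x)%:E)%E).
- by apply/measurable_EFinP; apply: measurable_funM => //; exact/measurable_EFinP.
- by move=> x _ /=; rewrite lee_fin !normrM (ger0_norm K0) ler_wpM2r.
- exact: integrableZl.
Qed.

(** Uniform convergence is integrated against the finite measure [rho dm]; [Rintegral_perturb]
    handles the possibly nonmeasurable [marchaud eta psi]. *)
Lemma Rintegral_marchaud_cvg rho psi (D : set R) : measurable D ->
  mu.-integrable [set: R] (EFin \o rho) -> (forall x, 0 <= rho x) ->
  C1_bounded_support psi ->
  \int[mu]_(x in D) (marchaud eta psi x * rho x) @[eta --> 1^'-] -->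
  \int[mu]_(x in D) (derive1 psi x * rho x).
Proof.
move=> mD irhoT rho0 Hpsi; have [B [K [_ HK]]] := C1_bounded_support_bounds _ Hpsi.
have irho : mu.-integrable D (EFin \o rho) by exact: integrableS irhoT.
have [_ cpsi _] := Hpsi.
have Ifin : (\int[mu]_(x in D) (rho x)%:E)%E \is a fin_num by exact: integrable_fin_num.
set I := fine (\int[mu]_(x in D) (rho x)%:E)%E.
have I0 : 0 <= I by rewrite fine_ge0// integral_ge0// => x _; rewrite lee_fin.
apply/cvgrPdist_le => e e0.
(* The 2 compensates the factor of [Rintegral_perturb], and I + 1 keeps the denominator positive
   when the mass on [D] is 0. *)
pose w := e / (2 * (I + 1)).
have w0 : 0 < w by rewrite divr_gt0// mulr_gt0// ltr_wpDl.
near=> eta.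
have H x : `|marchaud eta psi x - derive1 psi x| <= w.
  by move: x; near: eta; exact: marchaud_cvg_unif.
rewrite distrC.
apply: (@le_trans _ _ (2 * fine (\int[mu]_(x in D) (w%:E * (rho x)%:E))%E)).
  apply: Rintegral_perturb => //.
  - apply: (integrable_mul_bounded _ _ K) => //.
    by apply: measurable_funTS; exact: continuous_measurable_fun.
  - have mrho : measurable_fun D rho.
      by apply/measurable_EFinP; exact: measurable_int irho.
    by apply/measurable_EFinP; exact: measurable_funM.
  - by rewrite integralZl// ltey_eq fin_numM.
  - move=> x _; rewrite -EFinM lee_fin -mulrBl normrM (ger0_norm (rho0 x)).
    by rewrite ler_wpM2r.
rewrite integralZl// fineM// -/I /= /w.
have I1 : 0 < I + 1 by rewrite ltr_wpDl.
rewrite (_ : 2 * _ = e * (I / (I + 1))); last by field; rewrite gt_eqF.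
by rewrite ler_piMr ?(ltW e0)// ler_pdivrMr// mul1r lerDl.
Unshelve. all: by end_near. Qed.

End response.

(** * Increments of the primitive of the density *)

Section translated_primitive.
Context {R : realType}.
Notation mu := (@lebesgue_measure R).
Implicit Types (psi rho : R -> R) (h x y : R).

(* The y-kernel of rho |-> Rho (x - h) - Rho x, for a primitive Rho of rho. *)
Definition jump h (p : R * R) : R :=
  \1_[set p : R * R | p.2 <= p.1 - h] p - \1_[set p : R * R | p.2 <= p.1] p.

Lemma measurable_jump h : measurable_fun [set: R * R] (jump h).
Proof.
have m (c : R) : measurable [set p : R * R | p.2 <= p.1 - c].
  rewrite (_ : mkset _ = (fun p => p.1 - c - p.2) @^-1` `[0, +oo[).
    rewrite -[X in measurable X]setTI.
    apply: measurable_funB => //; apply: measurable_funB => //.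
  by apply/seteqP; split => p /=; rewrite in_itv/= andbT subr_ge0.
apply: measurable_funB; apply: measurable_indic; first exact: m.
by have := m 0; under eq_set do rewrite subr0.
Qed.

Lemma jumpE h x y : jump h (x, y) = (y + h <= x)%R%:R - (y <= x)%R%:R.
Proof.
rewrite /jump !indicE; congr ((nat_of_bool _)%:R - (nat_of_bool _)%:R); last first.
  by apply/idP/idP; rewrite inE.
by apply/idP/idP; rewrite inE /= lerBrDr.
Qed.

Lemma jumpE_ge0 h x y : 0 <= h -> jump h (x, y) = - \1_`[y, y + h[ x.
Proof.
move=> h0; rewrite jumpE indicE (_ : (x \in _) = (y <= x) && (x < y + h)).
  by case: (leP (y + h) x); case: (leP y x) => /= ? ?; lra.
by apply/idP/idP; rewrite inE /= in_itv.
Qed.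

Lemma jumpE_lt0 h x y : h < 0 -> jump h (x, y) = \1_`[y + h, y[ x.
Proof.
move=> h0; rewrite jumpE indicE (_ : (x \in _) = (y + h <= x) && (x < y)).
  by case: (leP (y + h) x); case: (leP y x) => /= ? ?; lra.
by apply/idP/idP; rewrite inE /= in_itv.
Qed.

Lemma integral_norm_jump h y : (\int[mu]_x `|jump h (x, y)|%:E = `|h|%:E)%E.
Proof.
have [h0|h0] := leP 0 h.
  under eq_integral do rewrite (jumpE_ge0 _ _ _ h0) normrN ger0_norm//.
  rewrite integral_indic//= setIT lebesgue_measure_itv/= lte_fin.
  rewrite ger0_norm//; case: ltP => hy; first by rewrite -EFinD addrAC subrr add0r.
  by congr EFin; lra.
under eq_integral do rewrite (jumpE_lt0 _ _ _ h0) ger0_norm//.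
rewrite integral_indic//= setIT lebesgue_measure_itv/= lte_fin.
rewrite ltr0_norm//; case: ltP => hy; first by rewrite -EFinD opprD addrA subrr add0r.
by congr EFin; lra.
Qed.

Lemma integral_derive1 psi (a b : R) : a <= b -> C1_bounded_support psi ->
  (\int[mu]_(x in `[a, b[) (derive1 psi x)%:E = (psi b - psi a)%:E)%E.
Proof.
move=> ab [dpsi cpsi _].
have mpsi : measurable_fun [set: R] (derive1 psi) by exact: continuous_measurable_fun.
move: ab; rewrite le_eqVlt => /predU1P[<-|ab].
  by rewrite set_itvco0 integral_set0 subrr.
rewrite integral_itv_bndo_bndc; last by apply/measurable_EFinP; exact: measurable_funTS.
have c (x : R) : {for x, continuous psi}.
  exact/differentiable_continuous/derivable1_diffP.
have cw : {within `[a, b], continuous (derive1 psi)} by exact: continuous_subspaceT.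
have dw : derivable_oo_LRcontinuous psi a b.
  split; [by move=> x _; exact: dpsi| |].
    exact: cvg_at_right_filter (c a).
  exact: cvg_at_left_filter (c b).
by rewrite (continuous_FTC2 ab cw dw (fun x _ => erefl)) EFinB.
Qed.

(** Integration by parts at the level of the kernel: up to sign, [jump] is the indicator of the
    interval between y and y + h, so the fundamental theorem for [psi] suffices and there are no
    boundary terms. *)
Lemma integral_jump_derive1 psi h y : C1_bounded_support psi ->
  (\int[mu]_x (jump h (x, y) * derive1 psi x)%:E = (- (psi (y + h) - psi y))%:E)%E.
Proof.
move=> Hpsi.
have E (a b : R) : (\int[mu]_x (\1_`[a, b[ x * derive1 psi x)%:E =
    \int[mu]_(x in `[a, b[) (derive1 psi x)%:E)%E.
  rewrite [RHS]integral_mkcond; apply: eq_integral => x _.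
  by rewrite /patch indicE; case: ifP => _; rewrite ?mul1r ?mul0r.
have [h0|h0] := leP 0 h.
  under eq_integral do rewrite (jumpE_ge0 _ _ _ h0) mulNr EFinN.
  have [_ [K [_ HK]]] := C1_bounded_support_bounds _ Hpsi.
  have I : mu.-integrable [set: R] (fun x => (\1_`[y, (y + h)%R[ x * derive1 psi x)%:E).
    rewrite (_ : (fun x => _) = EFin \o (fun x => derive1 psi x * \1_`[y, y + h[ x)).
      apply: (integrable_mul_bounded _ _ K) => //; first exact: integrable_indic_itv.
      by apply: continuous_measurable_fun; case: Hpsi.
    by apply/funext => x /=; rewrite mulrC.
  rewrite integralN /=; last exact: integrable_add_def I.
  by rewrite E integral_derive1// lerDl.
under eq_integral do rewrite (jumpE_lt0 _ _ _ h0).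
by rewrite E integral_derive1 ?opprB// gerDl ltW.
Qed.

End translated_primitive.

Section translated_primitive_integrals.
Context {R : realType} (rho : R -> R).
Notation mu := (@lebesgue_measure R).
Hypothesis rho0 : forall x, 0 <= rho x.
Hypothesis irho : mu.-integrable [set: R] (EFin \o rho).
Implicit Types (psi : R -> R) (h x y : R).

Notation Rho := (primitive_from rho).

Let mrho : measurable_fun [set: R] rho.
Proof. by apply/measurable_EFinP; exact: measurable_int irho. Qed.

Let mass : R := \int[mu]_x rho x.

Let massE : (\int[mu]_x (rho x)%:E)%E = mass%:E.
Proof. by rewrite fineK//; exact: integrable_fin_num. Qed.

Lemma norm_jump_le1 h (p : R * R) : `|jump h p| <= 1.
Proof.
case: p => x y; rewrite jumpE.
by case: (y + h <= x); case: (y <= x); rewrite /= ler_norml; lra.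
Qed.

Lemma primitive_fromB h x :
  ((Rho (x - h) - Rho x)%:E = \int[mu]_y (rho y * jump h (x, y))%:E)%E.
Proof.
have iI z : mu.-integrable [set: R] (fun y => (rho y * \1_`]-oo, z] y)%:E).
  rewrite (_ : (fun y => _) = (EFin \o rho) \_ `]-oo, z]).
    by rewrite -integrable_mkcond//; apply: integrableS irho.
  apply/funext => y; rewrite /patch indicE; case: ifP => _; rewrite ?mulr1 ?mulr0//.
have RhoE z : ((Rho z)%:E = \int[mu]_y (rho y * \1_`]-oo, z] y)%:E)%E.
  rewrite /primitive_from /Rintegral fineK; last first.
    by apply: integrable_fin_num => //; apply: integrableS irho.
  rewrite integral_mkcond; apply: eq_integral => y _.
  by rewrite /patch indicE; case: ifP => _; rewrite ?mulr1 ?mulr0.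
rewrite EFinB !RhoE -integralB//; apply: eq_integral => y _.
rewrite /= -EFinB -mulrBr jumpE !indicE; congr (_ * (_ - _))%:E.
  by congr (nat_of_bool _)%:R; apply/idP/idP; rewrite inE /= in_itv/= lerBrDr.
by congr (nat_of_bool _)%:R; apply/idP/idP; rewrite inE /= in_itv/=.
Qed.

Lemma measurable_rho_jump h :
  measurable_fun [set: R * R] (fun p => rho p.2 * jump h p).
Proof.
apply: measurable_funM; last exact: measurable_jump.
exact: measurableT_comp.
Qed.

Lemma integral_norm_rho_jump h :
  (\int[mu]_y \int[mu]_x `|rho y * jump h (x, y)|%:E = (`|h| * mass)%:E)%E.
Proof.
transitivity (\int[mu]_y (`|h|%:E * (rho y)%:E))%E.
  apply: eq_integral => y _.
  transitivity (\int[mu]_x ((rho y)%:E * `|jump h (x, y)|%:E))%E.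
    by apply: eq_integral => x _; rewrite normrM ger0_norm// EFinM.
  rewrite ge0_integralZl//=.
  - by rewrite integral_norm_jump muleC.
  - apply/measurable_EFinP; apply: measurableT_comp => //.
    exact: (measurableT_comp (measurable_jump h)).
  - by rewrite lee_fin.
by rewrite integralZl// massE EFinM.
Qed.

Lemma integrable_rho_jump h :
  (mu \x mu)%E.-integrable [set: R * R] (fun p => (rho p.2 * jump h p)%:E).
Proof.
apply/integrable21ltyP; first by apply/measurable_EFinP; exact: measurable_rho_jump.
by rewrite /= integral_norm_rho_jump ltry.
Qed.

(** The L^1 Lipschitz bound, valid for an unbounded density: by Tonelli each y contributes the
    length |h| of the interval carried by [jump], weighted by [rho y]. *)
Lemma integral_norm_primitive_fromB h :
  (\int[mu]_x `|Rho (x - h) - Rho x|%:E <= (`|h| * mass)%:E)%E.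
Proof.
rewrite -integral_norm_rho_jump.
rewrite -(@fubini_tonelli _ _ _ _ R mu mu (fun p => `|rho p.2 * jump h p|%:E))//=.
  apply: le_lower_integral => x _; first by rewrite lee_fin.
  rewrite (_ : `|_|%:E = `|(Rho (x - h) - Rho x)%:E|%E)// primitive_fromB.
  apply: le_abse_integral => //; apply/measurable_EFinP.
  apply: measurable_funM => //.
  exact: (measurableT_comp (measurable_jump h)).
- by apply/measurable_EFinP; apply: measurableT_comp => //; exact: measurable_rho_jump.
Qed.

(** Fubini for the kernel rho(y) jump_h(x, y) psi'(x): integrating in y gives the left side,
    integrating in x the right one. *)
Lemma integral_primitive_fromB_derive1 psi h : C1_bounded_support psi ->
  (\int[mu]_x ((Rho (x - h) - Rho x) * derive1 psi x)%:E =
   - \int[mu]_y (rho y * (psi (y + h) - psi y))%:E)%E.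
Proof.
move=> Hpsi; have [B [K [HB HK]]] := C1_bounded_support_bounds _ Hpsi.
have [_ cpsi _] := Hpsi.
have mpsi : measurable_fun [set: R] (derive1 psi) by exact: continuous_measurable_fun.
have K0 : 0 <= K by rewrite (le_trans _ (HK 0)).
have mjx x : measurable_fun [set: R] (fun y => jump h (x, y)).
  exact: (measurableT_comp (measurable_jump h)).
have mjy y : measurable_fun [set: R] (fun x => jump h (x, y)).
  exact: (measurableT_comp (measurable_jump h)).
transitivity (\int[mu]_x \int[mu]_y (rho y * jump h (x, y) * derive1 psi x)%:E)%E.
  apply: eq_integral => x _; rewrite EFinM primitive_fromB.
  rewrite -integralZr//.
  rewrite (_ : (fun y => _) = EFin \o (fun y => jump h (x, y) * rho y)).
    apply: (integrable_mul_bounded _ _ 1) => // y; exact: norm_jump_le1.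
  by apply/funext => y /=; rewrite mulrC.
rewrite (@Fubini _ _ _ _ R mu mu (fun p => (rho p.2 * jump h p * derive1 psi p.1)%:E)); last first.
  apply: (@le_integrable _ _ _ _ _ measurableT _ _ _ _
    (integrableZl measurableT K (integrable_rho_jump h))).
  - apply/measurable_EFinP; apply: measurable_funM; first exact: measurable_rho_jump.
    exact: measurableT_comp.
  - move=> p _ /=; rewrite lee_fin mulrC normrM [leRHS]normrM (ger0_norm K0).
    by rewrite ler_wpM2r.
have iE y : (\int[mu]_x (rho y * jump h (x, y) * derive1 psi x)%:E =
    (- (rho y * (psi (y + h) - psi y)))%:E)%E.
  under eq_integral do rewrite -mulrA EFinM.
  rewrite integralZl//.
    by rewrite integral_jump_derive1// -EFinM mulrN.
  have ij : mu.-integrable [set: R] (EFin \o (fun x => jump h (x, y))).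
    apply/integrableP; split; first by apply/measurable_EFinP; exact: mjy.
    by rewrite /= integral_norm_jump ltry.
  rewrite (_ : (fun x => _) = EFin \o (fun x => derive1 psi x * jump h (x, y))).
    by apply: (integrable_mul_bounded _ _ K).
  by apply/funext => x /=; rewrite mulrC.
under eq_integral do rewrite iE EFinN.
rewrite integralN//; apply: integrable_add_def => //.
rewrite (_ : (fun y => _) = EFin \o (fun y => (psi (y + h) - psi y) * rho y)).
  apply: (integrable_mul_bounded _ _ (2 * B)) => //.
    have mp : measurable_fun [set: R] psi.
      by apply: continuous_measurable_fun; exact: C1_bounded_support_continuous.
    apply: measurable_funB => //; apply: (measurableT_comp mp).
    exact: measurable_funD.
  move=> y; rewrite (le_trans (ler_normB _ _))//.
  by have := HB y; have := HB (y + h); lra.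
by apply/funext => y /=; rewrite mulrC.
Qed.

End translated_primitive_integrals.

(** * Fubini for the parameter derivative *)

Section parameter_derivative.
Context {R : realType}.
Notation mu := (@lebesgue_measure R).
Implicit Types (psi rho : R -> R) (t eps eta h x y delta : R).

(* The displacement of the parameter in the extended family. *)
Definition tclamp t eps delta : R := clamp t eps (t + delta) - t.

Lemma tclamp_id t eps delta : `|delta| <= eps -> tclamp t eps delta = delta.
Proof.
rewrite ler_norml => /andP[d1 d2]; rewrite /tclamp /clamp.
by case: ltP => ?; [lra|case: ltP => ?; lra].
Qed.

Lemma norm_tclamp_le t eps delta : 0 <= eps -> `|tclamp t eps delta| <= eps.
Proof.
move=> e0; rewrite /tclamp /clamp ler_norml.
by case: ltP => ?; [lra|case: ltP => ?; lra].
Qed.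

Lemma measurable_tclamp t eps : 0 <= eps -> measurable_fun [set: R] (tclamp t eps).
Proof.
move=> e0; apply: nondecreasing_measurable => // x y xy; rewrite /tclamp /clamp.
by case: (ltP (t + x)) => ?; case: (ltP (t + y)) => ?; try case: ltP => ?; try case: ltP => ?; lra.
Qed.

Lemma primitive_from_nondecreasing rho : (forall x, 0 <= rho x) ->
  mu.-integrable [set: R] (EFin \o rho) ->
  {homo primitive_from rho : x y / x <= y}.
Proof.
move=> rho0 irho x y xy; rewrite /primitive_from /Rintegral.
have mrho := measurable_int _ irho.
have iS (z : R) : mu.-integrable `]-oo, z] (EFin \o rho) by apply: integrableS irho.
apply: fine_le; [exact: integrable_fin_num|exact: integrable_fin_num|].
apply: ge0_subset_integral => //.
- exact: measurable_funTS.
- by move=> z _; rewrite lee_fin.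
- by apply: subset_itvl; rewrite bnd_simp.
Qed.

Lemma EFin_integralZl (g : R -> R) (c : R) : mu.-integrable [set: R] (EFin \o g) ->
  (\int[mu]_x (c * g x)%:E = (c * \int[mu]_x g x)%:E)%E.
Proof.
move=> ig; rewrite EFinM [X in (_ = _ * X)%E]fineK; last exact: integrable_fin_num.
by rewrite -integralZl//; apply: eq_integral => x _; rewrite EFinM.
Qed.

Section fubini.
Variables (rho psi : R -> R) (t eps eta : R).
Hypothesis rho0 : forall x, 0 <= rho x.
Hypothesis irho : mu.-integrable [set: R] (EFin \o rho).
Hypothesis eps0 : 0 < eps.
Hypothesis eta01 : 0 < eta < 1.
Hypothesis Hpsi : C1_bounded_support psi.

Notation cl := (tclamp t eps).
Notation Rho := (primitive_from rho).

(** The bare kernel, not integrable near 0; it serves only as a factor of increments. *)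
Let kappa delta := mker eta (cst 1) delta.

Let mkerE g delta : mker eta g delta = g delta * kappa delta.
Proof. by rewrite /kappa /mker mul1r mulrA. Qed.

Let mkappa : measurable_fun [set: R] kappa.
Proof. by apply: measurable_mker; exact: measurable_cst. Qed.

Let mRho : measurable_fun [set: R] Rho.
Proof.
by apply: nondecreasing_measurable => // x y; exact: primitive_from_nondecreasing.
Qed.

Let H (p : R * R) := (Rho (p.1 - cl p.2) - Rho p.1) * kappa p.2.

Let mH : measurable_fun [set: R * R] H.
Proof.
have mcl : measurable_fun [set: R] cl by apply: measurable_tclamp; exact: ltW.
apply: measurable_funM; last exact: measurableT_comp.
apply: measurable_funB; last exact: measurableT_comp.
apply: (measurableT_comp mRho); apply: measurable_funB => //.
exact: measurableT_comp.
Qed.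

Let mDelta h : measurable_fun [set: R] (fun x => Rho (x - h) - Rho x).
Proof.
apply: measurable_funB => //; apply: (measurableT_comp mRho).
exact: measurable_funB.
Qed.

(** Integrating in x before delta is essential: the x-integral is at most |cl delta| times the mass,
    and the factor |cl delta| tames the kernel, being |delta| near 0 and at most [eps]
    everywhere. *)
Lemma integrable_translated_primitive :
  (mu \x mu)%E.-integrable [set: R * R]
    (fun p => (mker eta (fun delta => Rho (p.1 - cl delta) - Rho p.1) p.2)%:E).
Proof.
rewrite (_ : (fun p => _) = EFin \o H); last first.
  by apply/funext => p; rewrite mkerE.
apply/integrable21ltyP; first exact/measurable_EFinP.
have Icl : mu.-integrable [set: R] (EFin \o mker eta cl).
  (* [cl] is the identity on |delta| <= eps and bounded by [eps]: radius [eps], slope 1, error 0,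
     bound [eps]. *)
  apply: (integrable_mker eta eps 1 0 eps) => //.
  - by apply: measurable_tclamp; exact: ltW.
  - by move=> x xe; rewrite tclamp_id// mul1r subrr normr0 mul0r.
  - by move=> x; apply: norm_tclamp_le; exact: ltW.
have [mcl] := integrableP _ _ _ Icl.
set C := (\int[mu]_x _)%E => Coo.
pose mass := \int[mu]_x rho x.
have mass0 : 0 <= mass by exact: Rintegral_ge0.
apply: (@le_lt_trans _ _ (mass%:E * C)%E); last by rewrite lte_mul_pinfty ?lee_fin.
rewrite /C -ge0_integralZl//; last exact: measurableT_comp.
apply: le_lower_integral => delta _; first by apply: integral_ge0.
have -> : (\int[mu]_x `|(EFin \o H) (x, delta)| =
    `|kappa delta|%:E * \int[mu]_x `|Rho (x - cl delta) - Rho x|%:E)%E.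
  rewrite -ge0_integralZl//=.
  - by apply: eq_integral => x _; rewrite /H/= normrM mulrC.
  - by apply/measurable_EFinP; apply: measurableT_comp => //; exact: mDelta.
have -> : (`|(EFin \o mker eta cl) delta| = (`|cl delta| * `|kappa delta|)%:E)%E.
  by rewrite -normrM -mkerE.
have Hn := integral_norm_primitive_fromB rho rho0 irho (cl delta).
apply: (@le_trans _ _ (`|kappa delta|%:E * (`|cl delta| * mass)%:E)%E).
  by apply: lee_wpmul2l => //; rewrite lee_fin.
by rewrite -!EFinM lee_fin le_eqVlt; apply/orP; left; apply/eqP; ring.
Qed.

Definition shift_mean (h : R) : R :=
  \int[mu]_y (rho y * (psi (y + h) - psi y)).

Let shift_meanE h :
  ((shift_mean h)%:E = \int[mu]_y (rho y * (psi (y + h) - psi y))%:E)%E.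
Proof.
have [B [_ [HB _]]] := C1_bounded_support_bounds _ Hpsi.
rewrite fineK//; apply: integrable_fin_num => //.
rewrite (_ : (fun y => _) = EFin \o (fun y => (psi (y + h) - psi y) * rho y)).
  apply: (integrable_mul_bounded _ _ (2 * B)) => //.
    have mp : measurable_fun [set: R] psi.
      by apply: continuous_measurable_fun; exact: C1_bounded_support_continuous.
    apply: measurable_funB => //; apply: (measurableT_comp mp).
    exact: measurable_funD.
  move=> y; rewrite (le_trans (ler_normB _ _))//.
  by have := HB y; have := HB (y + h); lra.
by apply/funext => y /=; rewrite mulrC.
Qed.

(* The value of f is only prescribed where the kernel integral converges: elsewhere,
   on a null set, the limit defining marchaud is a junk value. *)
Lemma integral_translated_primitive (f : R -> R) :
  (forall x, mu.-integrable [set: R]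
      (EFin \o mker eta (fun delta => Rho (x - cl delta) - Rho x)) ->
    f x = mcst eta * \int[mu]_delta mker eta (fun delta => Rho (x - cl delta) - Rho x) delta) ->
  - (\int[mu]_x (f x * derive1 psi x)) =
    mcst eta * \int[mu]_delta mker eta (shift_mean \o cl) delta.
Proof.
move=> fE; have IH := integrable_translated_primitive.
have [_ [K [_ HK]]] := C1_bounded_support_bounds _ Hpsi.
have mpsi : measurable_fun [set: R] (derive1 psi).
  by apply: continuous_measurable_fun; case: Hpsi.
have IHpsi : (mu \x mu)%E.-integrable [set: R * R] (fun p =>
    (derive1 psi p.1 * mker eta (fun delta => Rho (p.1 - cl delta) - Rho p.1) p.2)%:E).
  have K0 : 0 <= K by rewrite (le_trans _ (HK 0)).
  apply: (@le_integrable _ _ _ _ _ measurableT _ _ _ _ (integrableZl measurableT K IH)).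
  - apply/measurable_EFinP; apply: measurable_funM; first exact: measurableT_comp.
    by apply/measurable_EFinP; exact: measurable_int IH.
  - move=> p _; rewrite -EFinM /= lee_fin normrM [leRHS]normrM (ger0_norm K0).
    by rewrite ler_wpM2r.
have inner delta : (\int[mu]_x (derive1 psi x *
    mker eta (fun delta => Rho (x - cl delta) - Rho x) delta)%:E =
    - (mker eta (shift_mean \o cl) delta)%:E)%E.
  have ID : mu.-integrable [set: R] (EFin \o (fun x => Rho (x - cl delta) - Rho x)).
    apply/integrableP; split; first by apply/measurable_EFinP; exact: mDelta.
    by apply: le_lt_trans (integral_norm_primitive_fromB rho rho0 irho (cl delta)) _; rewrite ltry.
  transitivity (\int[mu]_x ((kappa delta)%:E *
      ((Rho (x - cl delta) - Rho x) * derive1 psi x)%:E))%E.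
    by apply: eq_integral => x _; rewrite mkerE -EFinM; congr EFin; ring.
  rewrite integralZl//; last first.
    rewrite (_ : (fun x => _) = EFin \o (fun x => derive1 psi x * (Rho (x - cl delta) - Rho x))).
      exact: (integrable_mul_bounded _ _ K).
    by apply/funext => x /=; rewrite mulrC.
  rewrite integral_primitive_fromB_derive1// -shift_meanE mkerE.
  by rewrite -EFinN -EFinM -EFinN; congr EFin; rewrite /=; ring.
have IFub := integrable_fubini_F IHpsi.
have Fub : (\int[mu]_x \int[mu]_delta (derive1 psi x *
      mker eta (fun delta => Rho (x - cl delta) - Rho x) delta)%:E =
    \int[mu]_delta (- (mker eta (shift_mean \o cl) delta)%:E))%E.
  by apply: (etrans (Fubini IHpsi)); apply: eq_integral => delta _; exact: inner.
have E : (\int[mu]_x (f x * derive1 psi x)%:E =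
    (mcst eta)%:E * \int[mu]_delta (- (mker eta (shift_mean \o cl) delta)%:E))%E.
  rewrite -Fub -(integralZl measurableT IFub).
  (* Both the value of [f] and its measurability are uncontrolled off the set where the kernel
     integral converges; that set has full measure by Fubini. *)
  apply: ae_eq_lower_integral.
    apply: measurable_funeM; exact: measurable_int IFub.
  have [B [mB B0 BI]] := ae_integrable1 IH.
  exists B; split; [exact: mB|exact: B0|move=> x /= h].
  apply: BI => /= Ix; apply: h.
  have Ix' : mu.-integrable [set: R]
      (EFin \o mker eta (fun delta => Rho (x - cl delta) - Rho x)) := Ix.
  have zl := EFin_integralZl _ (derive1 psi x) Ix'.
  rewrite (fE x Ix').
  rewrite -[mcst eta * _ * _]mulrA [X in mcst eta * X]mulrC EFinM -zl; exact: erefl.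
have IJ : mu.-integrable [set: R] (EFin \o mker eta (shift_mean \o cl)).
  have mI := measurable_int _ IHpsi.
  apply/integrableP; split.
    (* Measurability in delta is inherited from Fubini, since by [inner] the function is minus the
       integral in x. *)
    have := measurableT_comp (@oppe_measurable R setT) (measurable_fubini_G IHpsi).
    by congr (measurable_fun _ _); apply/funext => delta; rewrite /= /fubini_G inner oppeK.
  have fin := (integrable21ltyP _ _ mI).1 IHpsi.
  apply: (le_lt_trans _ fin).
  apply: le_lower_integral => delta _; first exact: abse_ge0.
  rewrite -[X in (X <= _)%E]abseN -[X in `|X|%E]/(- (mker eta (shift_mean \o cl) delta)%:E)%E -inner.
  apply: le_abse_integral; first exact: measurableT.
  exact: (measurableT_comp mI (pair2_measurable delta)).
have Jfin := integrable_fin_num measurableT IJ.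
rewrite /Rintegral E integralN/=; last exact: integrable_add_def.
rewrite -[X in fine (_ * - X)%E](fineK Jfin) -EFinN -EFinM /=.
by rewrite mulrN opprK.
Qed.

End fubini.
End parameter_derivative.

(** * The frequency side *)

Section frequency.
Context {R : realType} (t : R) (nu : probability (measurableTypeR R) R).
Context (rho : R -> R) (rho_acip : acip_density t nu rho).
Notation mu := (@lebesgue_measure R).
Implicit Types (f psi : R -> R) (eps eta : R).

Let rho0 x : 0 <= rho x := acip_ge0 rho_acip x.
Let irho : mu.-integrable [set: R] (EFin \o rho) := acip_integrable _ _ _ rho_acip.
Let mass1 : \int[mu]_x rho x = 1.
Proof. by rewrite /Rintegral (acip_integral1 _ _ _ rho_acip). Qed.

Let integrable_mulr f B : measurable_fun [set: R] f -> (forall x, `|f x| <= B) ->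
  mu.-integrable [set: R] (EFin \o (fun x => f x * rho x)).
Proof. exact: integrable_mul_bounded. Qed.

(** As [rho] has mass 1, averaging against it preserves uniform bounds with the same constant; the
    mean increment thus inherits the slope, error and size estimates of [psi]. *)
Let norm_Rintegral f c : mu.-integrable [set: R] (EFin \o (fun x => f x * rho x)) ->
  (forall x, `|f x| <= c) -> `|\int[mu]_x (f x * rho x)| <= c.
Proof.
move=> iF fc; apply: (le_trans (le_normr_Rintegral _ iF)) => //.
rewrite -[leRHS]mulr1 -mass1 -RintegralZl//; apply: le_Rintegral => //.
- by have := integrable_norm iF.
- by have := integrableZl measurableT c irho.
- by move=> x _; rewrite /= normrM (ger0_norm (rho0 x)) ler_wpM2r.
Qed.

Lemma pairing_cvg eps psi : 0 < eps -> C1_bounded_support psi ->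
  marchaud_transfer_pairing eta t eps rho psi @[eta --> 1^'-] -->
  \int[mu]_x (derive1 psi x * rho x).
Proof.
move=> eps0 Hpsi; have [B [K [HB HK]]] := C1_bounded_support_bounds _ Hpsi.
have [_ cdpsi _] := Hpsi; have cpsi := C1_bounded_support_continuous _ Hpsi.
apply/cvgrPdist_le => e e0.
have w0 : 0 < e / 4 by rewrite divr_gt0.
have [r r0 Hr] := C1_bounded_support_unif_derivable _ Hpsi _ w0.
(* Below [r] the linear approximation of [psi] holds, and below [eps] the clamp is inactive; both
   are required. *)
have m0 : 0 < Num.min r eps by rewrite lt_min r0.
set a := \int[mu]_x _.
have mpsi := continuous_measurable_fun cpsi.
have ia := integrable_mulr _ _ (continuous_measurable_fun cdpsi) HK.
have HB2 h x : `|psi (x + h) - psi x| <= 2 * B.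
  by rewrite (le_trans (ler_normB _ _))//; have := HB x; have := HB (x + h); lra.
have id h : mu.-integrable [set: R] (EFin \o (fun x => (psi (x + h) - psi x) * rho x)).
  apply: (integrable_mulr _ (2 * B)) => //; apply: measurable_funB => //.
  by apply: (measurableT_comp mpsi); exact: measurable_funD.
have GE h : shift_mean rho psi h = \int[mu]_x ((psi (x + h) - psi x) * rho x).
  by rewrite /shift_mean; congr fine; apply: eq_integral => x _; rewrite mulrC.
near=> eta.
have eta01 : 0 < eta < 1.
  by apply/andP; split; near: eta; [exact: nbhs_left_gt|exact: nbhs_left_lt].
rewrite distrC (_ : marchaud_transfer_pairing _ _ _ _ _ =
  mcst eta * \int[mu]_delta mker eta (shift_mean rho psi \o tclamp t eps) delta); last first.
  apply: integral_translated_primitive => //.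
  have E x : (fun delta => cumul t eps rho (t + delta) x - cumul t eps rho t x) =
      (fun delta => primitive_from rho (x - tclamp t eps delta) - primitive_from rho x).
    apply/funext => delta; rewrite !(acip_cumul _ _ _ rho_acip) /tclamp.
    congr (_ - primitive_from rho _).
    have := tclamp_id t eps 0; rewrite normr0 (ltW eps0) /tclamp addr0 => -> //.
    by rewrite subr0.
  by move=> x Ix; rewrite marchaudE E.
rewrite [leRHS](_ : e = 4 * (e / 4)); last by field.
have M : forall (g : R -> R) b, `|b| <= K ->
    (forall x : R, `|x| <= Num.min r eps -> `|g x - b * x| <= e / 4 * `|x|) ->
    (forall x, `|g x| <= 2 * B) ->
    `|mcst eta * \int[mu]_u mker eta g u - b| <= 4 * (e / 4).
  by near: eta; exact: mker_limit.
apply: M.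
- exact: norm_Rintegral.
- move=> h; rewrite le_min => /andP[hr he]; rewrite /= tclamp_id// GE.
  rewrite mulrC -RintegralZl// -RintegralB//; last first.
    by have := integrableZl measurableT h ia.
  have E2 : (fun x => (psi (x + h) - psi x) * rho x - h * (derive1 psi x * rho x)) =
    (fun x => (psi (x + h) - psi x - derive1 psi x * h) * rho x).
    by apply/funext => x; ring.
  rewrite E2; apply: norm_Rintegral; last by move=> x; exact: Hr.
  rewrite -E2; have := integrableB measurableT (id h) (integrableZl measurableT h ia).
  by [].
- by move=> h; rewrite /= GE; apply: norm_Rintegral.
Unshelve. all: by end_near. Qed.

End frequency.

(** The parameter [t] itself is among those over which the intersection is taken. *)
Lemma core_interval_sub {R : realType} (t eps : R) : 0 < eps ->
  core_interval t eps `<=` qinterval t.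
Proof.
move=> e0; apply: subset_trans (@interior_subset _ _) _ => x; apply.
by rewrite /= in_itv/=; apply/andP; split; lra.
Qed.

Lemma acip_Rintegral_qinterval {R : realType} (t : R)
    (nu : probability (measurableTypeR R) R) (rho : R -> R) (eps : R) (f : R -> R) :
  acip_density t nu rho -> admissible_eps t rho eps -> measurable_fun [set: R] f ->
  \int[lebesgue_measure]_(x in qinterval t) (f x * rho x) =
  \int[lebesgue_measure]_(x in [set: R]) (f x * rho x).
Proof.
move=> rho_acip [e0 _ cC _] mf; have mrho := acip_measurable rho_acip.
have mfr : measurable_fun [set: R] (fun x => (f x * rho x)%:E).
  by apply/measurable_EFinP; exact: measurable_funM.
have [N [mN N0 NI]] := acip_ae0 _ _ _ rho_acip _
  (subset_trans cC (core_interval_sub _ _ e0)).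
congr fine; rewrite integral_mkcond; apply: ae_eq_integral => //.
  by apply: (measurable_restrictT _ _).1 => //; [exact: measurable_itv|exact: measurable_funTS].
exists N; split => // x /= h; apply: NI => /= h0; apply: h => _.
rewrite /patch; case: ifPn => // /negP xI; rewrite h0 ?mulr0//.
by move=> qx; apply: xI; rewrite inE.
Qed.

Theorem propositionD (R : realType) (t : R)
  (mu : probability (measurableTypeR R) R) (rho : R -> R)
  (eps : R) (phi : R -> R)
  (t_gt1 : 1 < t) (t_lt2 : t < 2)
  (t_MT : misiurewicz_thurston t)
  (rho_acip : acip_density t mu rho)
  (t_mixing : mixing mu (quad t))
  (eps_small : admissible_eps t rho eps)
  (phi_C1c : C1_compact_support phi) :
  forall k : nat,
    Psi_fr eta t eps rho phi k @[eta --> 1^'-] --> Psi t rho phi k /\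
    Psi_rsp eta t rho phi k @[eta --> 1^'-] --> Psi t rho phi k.
Proof.
move=> k; have [eps0 _ _ _] := eps_small.
have Hpsi : C1_bounded_support (phi \o iter k (quad t)).
  by apply: C1_bounded_support_iter; exact: C1_compact_support_bounded.
split; first exact: (pairing_cvg _ _ _ rho_acip _ _ eps0 Hpsi).
(* The domains of integration are reconciled on the side of the limit, where the factor psi' is
   continuous, rather than on the side of [marchaud]. *)
rewrite /Psi -(acip_Rintegral_qinterval _ _ _ _ _ rho_acip eps_small).
  apply: Rintegral_marchaud_cvg => //; first exact: measurable_itv.
    exact: (acip_integrable _ _ _ rho_acip).
  exact: (acip_ge0 rho_acip).
by apply: continuous_measurable_fun; case: Hpsi.
Qed.
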